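(* Let $\gamma,\gamma'\in(0,1)$ with $\gamma+\gamma'<1$. There exists a constant $C_0=C_0(\gamma,\gamma')>0$ such that for every Borel set $A\subseteq[0,1]^2$ with $\lambda(A)=\gamma$ there exists a bijection $\phi_0:[0,1]^2\to[0,1]^2$ such that (1) $\phi_0$ is $C_0$-bi-Lipschitz, i.e. $\frac{1}{C_0}|x-y|\le|\phi_0(x)-\phi_0(y)|\le C_0|x-y|$ for all $x,y\in[0,1]^2$; (2) $\phi_0(x)=x$ for all $x\in\partial[0,1]^2$; (3) $\lambda(\phi_0(A))\ge 1-\gamma'$.
   Context: $\lambda$ denotes two-dimensional Lebesgue measure; $|\cdot|$ is the Euclidean norm on $\mathbb{R}^2$. *)

(* Defs.v *)
From Stdlib Require Import Reals.
Open Scope R_scope.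

Definition pt := (R * R)%type.
Definition set2 := pt -> Prop.

Definition dist2 (x y : pt) : R :=
  sqrt ((fst x - fst y)^2 + (snd x - snd y)^2).

Definition square (x : pt) : Prop :=
  0 <= fst x <= 1 /\ 0 <= snd x <= 1.

Definition square_boundary (x : pt) : Prop :=
  square x /\ (fst x = 0 \/ fst x = 1 \/ snd x = 0 \/ snd x = 1).

Definition open2 (U : set2) : Prop :=
  forall x, U x -> exists eps, 0 < eps /\ forall y, dist2 x y < eps -> U y.

Inductive borel2 : set2 -> Prop :=
  | borel_open : forall U, open2 U -> borel2 U
  | borel_compl : forall A, borel2 A -> borel2 (fun x => ~ A x)
  | borel_union : forall F : nat -> set2,
      (forall n, borel2 (F n)) -> borel2 (fun x => exists n, F n x).

Definition rect := (R * R * R * R)%type.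
Definition in_rect (r : rect) (x : pt) : Prop :=
  match r with (a, b, c, d) => a <= fst x <= b /\ c <= snd x <= d end.
Definition rect_ok (r : rect) : Prop :=
  match r with (a, b, c, d) => a <= b /\ c <= d end.
Definition rect_area (r : rect) : R :=
  match r with (a, b, c, d) => (b - a) * (d - c) end.

Definition cover_value (A : set2) (s : R) : Prop :=
  exists rs : nat -> rect,
    (forall n, rect_ok (rs n)) /\
    (forall x, A x -> exists n, in_rect (rs n) x) /\
    infinite_sum (fun n => rect_area (rs n)) s.

(* lebesgue_outer A m : m is the Lebesgue outer measure of A, i.e. the
   infimum of the total areas of countable rectangle covers of A.
   On Borel sets this is the Lebesgue measure lambda. *)
Definition lebesgue_outer (A : set2) (m : R) : Prop :=
  (forall s, cover_value A s -> m <= s) /\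
  (forall m', (forall s, cover_value A s -> m' <= s) -> m' <= m).

Definition image2 (f : pt -> pt) (A : set2) : set2 :=
  fun y => exists x, A x /\ f x = y.

(* Main.v *)
Require Import Defs.
From Stdlib Require Import Reals Lra Lia List Cantor FinFun.
From Stdlib Require Import Classical ClassicalEpsilon FunctionalExtensionality.
Open Scope R_scope.

(** It suffices to shrink the complement [B] of [A] to outer measure at most [gamma'].  One step
    decreases the measure of [B] by an amount depending only on [gamma] and [gamma'], using a shear
    [(x, y) |-> (x - v (x, y) / 16, y)], or its transpose, with an absolute bound on the Lipschitz
    constant of [v]; finitely many steps are then composed.

    Up to a set of small measure, [B] is a finite union of dyadic squares, with indicator [f], and
    the shear changes its measure by [- \int f d_x v / 16].  The field [v] is a sum [\sum_H w_H b_H]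
    over dyadic 2:1 rectangles [H], where [b_H] is the bilinear pyramid on [H] and
    [w_H |H| = \int f d_x b_H].  The functions [d_x b_H] are orthogonal, and so are the [d_y b_H];
    the sum is stopped in a rectangle as soon as its gradient there is large.  By orthogonality the
    stopped rectangles cover little area compared with [\sum w_H^2 |H|], so [v] is Lipschitz and
    [\int f d_x v] is at least half of the full sum [\sum w_H^2 |H|].  Comparison with the Haar
    expansion of [f] shows that, in one of the two coordinate directions, this sum is at least
    [Var f / 72]. *)

(** * Outer measure *)

(** Partial sums are bounded instead of requiring a convergent series, so that covers can be cut,
    merged and reordered without any convergence argument. *)
Definition outer_le (A : set2) (s : R) : Prop :=
  forall e, 0 < e -> exists rs : nat -> rect,
    (forall n, rect_ok (rs n)) /\
    (forall x, A x -> exists n, in_rect (rs n) x) /\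
    (forall n, sum_f_R0 (fun k => rect_area (rs k)) n <= s + e).

Lemma rect_area_ge0 r : rect_ok r -> 0 <= rect_area r.
Proof.
  destruct r as [[[a b] c] d]; simpl; intros [H1 H2].
  apply Rmult_le_pos; lra.
Qed.

Lemma sum_ge0 (f : nat -> R) n : (forall k, 0 <= f k) -> 0 <= sum_f_R0 f n.
Proof. intros H; induction n; simpl; [apply H | specialize (H (S n)); lra]. Qed.

Lemma sum_term_le (f : nat -> R) k n :
  (forall k, 0 <= f k) -> (k <= n)%nat -> f k <= sum_f_R0 f n.
Proof.
  intros H; induction n; intros Hk; simpl.
  - replace k with 0%nat by lia; lra.
  - destruct (Nat.eq_dec k (S n)) as [-> | Hne].
    + pose proof (sum_ge0 f n H); lra.
    + specialize (IHn ltac:(lia)); specialize (H (S n)); lra.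
Qed.

Lemma sum_le_index (f : nat -> R) n m :
  (forall k, 0 <= f k) -> (n <= m)%nat -> sum_f_R0 f n <= sum_f_R0 f m.
Proof.
  intros H Hnm; induction Hnm; simpl; [lra | specialize (H (S m)); lra].
Qed.

Lemma outer_le_mono (A B : set2) s t :
  (forall x, A x -> B x) -> s <= t -> outer_le B s -> outer_le A t.
Proof.
  intros HAB Hst HB e He; destruct (HB e He) as (rs & H1 & H2 & H3).
  exists rs; split; [exact H1 | split].
  - intros x Hx; apply H2, HAB, Hx.
  - intros n; specialize (H3 n); lra.
Qed.

Lemma outer_le_closed (A : set2) s :
  (forall e, 0 < e -> outer_le A (s + e)) -> outer_le A s.
Proof.
  intros H e He.
  destruct (H (e / 2) ltac:(lra) (e / 2) ltac:(lra)) as (rs & H1 & H2 & H3).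
  exists rs; repeat split; auto.
  intros n; specialize (H3 n); lra.
Qed.

Lemma outer_le_ge0 (A : set2) s : outer_le A s -> 0 <= s.
Proof.
  intros H; apply le_epsilon; intros e He.
  destruct (H e He) as (rs & H1 & _ & H3).
  specialize (H3 0%nat); simpl in H3.
  pose proof (rect_area_ge0 _ (H1 0%nat)); lra.
Qed.

Definition null_rect : rect := (0, 0, 0, 0).

Lemma outer_le_rect r : rect_ok r -> outer_le (in_rect r) (rect_area r).
Proof.
  intros Hr e He.
  exists (fun n => match n with O => r | _ => null_rect end); repeat split.
  - intros [|n]; [exact Hr | simpl; lra].
  - intros x Hx; exists 0%nat; exact Hx.
  - intros n.
    enough (sum_f_R0 (fun k => rect_area match k with O => r | _ => null_rect end) n
            = rect_area r) by lra.
    induction n; simpl in *; [reflexivity | rewrite IHn; ring].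
Qed.

Lemma outer_le_empty : outer_le (fun _ => False) 0.
Proof.
  apply outer_le_mono with (in_rect null_rect) (rect_area null_rect).
  - tauto.
  - simpl; lra.
  - apply outer_le_rect; simpl; lra.
Qed.

(** * Finite sums and countable subadditivity *)

Fixpoint lsum {T : Type} (g : T -> R) (l : list T) : R :=
  match l with nil => 0 | x :: l => g x + lsum g l end.

Lemma lsum_app {T : Type} (g : T -> R) l1 l2 : lsum g (l1 ++ l2) = lsum g l1 + lsum g l2.
Proof. induction l1; simpl; lra. Qed.

Lemma lsum_map {T S : Type} (g : T -> R) (f : S -> T) l :
  lsum g (map f l) = lsum (fun x => g (f x)) l.
Proof. induction l; simpl; congruence. Qed.

Lemma lsum_ge0 {T : Type} (g : T -> R) l : (forall x, 0 <= g x) -> 0 <= lsum g l.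
Proof. intros H; induction l as [|x l IH]; simpl; [lra | specialize (H x); lra]. Qed.

Lemma lsum_incl {T : Type} (g : T -> R) l l' :
  (forall x, 0 <= g x) -> NoDup l -> incl l l' -> lsum g l <= lsum g l'.
Proof.
  intros Hg Hl; revert l'; induction Hl as [|x l Hx Hl IH]; intros l' Hi; simpl.
  - apply lsum_ge0, Hg.
  - destruct (in_split x l') as (l1 & l2 & ->); [apply Hi; left; reflexivity|].
    rewrite lsum_app; simpl.
    enough (lsum g l <= lsum g (l1 ++ l2)) by (rewrite lsum_app in H; lra).
    apply IH; intros y Hy.
    specialize (Hi y (or_intror Hy)).
    apply in_app_iff in Hi; apply in_app_iff; destruct Hi as [|[->|]]; tauto.
Qed.

Lemma lsum_seq (f : nat -> R) n : lsum f (seq 0 (S n)) = sum_f_R0 f n.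
Proof.
  induction n; [simpl; ring|].
  rewrite seq_S, lsum_app, IHn; simpl; ring.
Qed.

Lemma lsum_list_prod (g : nat * nat -> R) l l' :
  lsum g (list_prod l l') = lsum (fun i => lsum (fun j => g (i, j)) l') l.
Proof.
  induction l; simpl; [reflexivity|].
  rewrite lsum_app, lsum_map, IHl; reflexivity.
Qed.

(** Neither coordinate of a pair exceeds its Cantor code, so the codes up to [n] enumerate, without
    repetition, part of the square of pairs with coordinates at most [n]. *)
Lemma sum_cantor_le (g : nat -> nat -> R) n :
  (forall i j, 0 <= g i j) ->
  sum_f_R0 (fun k => g (fst (of_nat k)) (snd (of_nat k))) n
  <= sum_f_R0 (fun i => sum_f_R0 (g i) n) n.
Proof.
  intros Hg.
  rewrite <- lsum_seq, <- (lsum_seq (fun i => sum_f_R0 (g i) n)).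
  apply Rle_trans with (lsum (fun p => g (fst p) (snd p)) (map of_nat (seq 0 (S n)))).
  { rewrite lsum_map; apply Rle_refl. }
  apply Rle_trans with (lsum (fun p => g (fst p) (snd p))
                          (list_prod (seq 0 (S n)) (seq 0 (S n)))).
  - apply lsum_incl.
    + intros; apply Hg.
    + apply Injective_map_NoDup; [|apply seq_NoDup].
      intros x y H; rewrite <- (cancel_to_of x), H, cancel_to_of; reflexivity.
    + intros [i j] Hin; apply in_map_iff in Hin; destruct Hin as (k & Hk & Hin).
      apply in_seq in Hin.
      pose proof (to_nat_non_decreasing i j) as Hij.
      rewrite <- Hk, cancel_to_of in Hij.
      apply in_prod; apply in_seq; lia.
  - rewrite lsum_list_prod.
    apply Req_le; apply f_equal2; [|reflexivity].
    apply functional_extensionality; intros i.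
    apply (lsum_seq (g i)).
Qed.

Lemma sum_half_pow n : sum_f_R0 (fun k => (/ 2) ^ (S k)) n <= 1.
Proof.
  enough (sum_f_R0 (fun k => (/ 2) ^ (S k)) n = 1 - (/ 2) ^ (S n)).
  { rewrite H; pose proof (pow_lt (/ 2) (S n) ltac:(lra)); lra. }
  induction n; [simpl; lra|].
  rewrite tech5, IHn; simpl; lra.
Qed.

(** The cover of [F n] is allowed the error [e / 2^(n+1)], and all covers are enumerated together
    along the Cantor pairing. *)
Lemma outer_le_countable (F : nat -> set2) (s : nat -> R) t :
  (forall n, outer_le (F n) (s n)) -> (forall n, sum_f_R0 s n <= t) ->
  outer_le (fun x => exists n, F n x) t.
Proof.
  intros HF Hs e He.
  assert (He' : forall n, 0 < e * (/ 2) ^ (S n)).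
  { intros n; apply Rmult_lt_0_compat; [exact He | apply pow_lt; lra]. }
  set (c := fun n => proj1_sig
              (constructive_indefinite_description _ (HF n _ (He' n)))).
  assert (Hc : forall n,
    (forall k, rect_ok (c n k)) /\
    (forall x, F n x -> exists k, in_rect (c n k) x) /\
    (forall k, sum_f_R0 (fun k => rect_area (c n k)) k <= s n + e * (/ 2) ^ (S n))).
  { intros n; unfold c.
    exact (proj2_sig (constructive_indefinite_description _ (HF n _ (He' n)))). }
  exists (fun k => c (fst (of_nat k)) (snd (of_nat k))); repeat split.
  - intros n; apply (Hc _).
  - intros x [n Hn]; destruct (proj1 (proj2 (Hc n)) x Hn) as [k Hk].
    exists (to_nat (n, k)); rewrite cancel_of_to; exact Hk.
  - intros n.
    eapply Rle_trans.
    { apply (sum_cantor_le (fun i j => rect_area (c i j))).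
      intros i j; apply rect_area_ge0, (Hc i). }
    apply Rle_trans with (sum_f_R0 (fun i => s i + e * (/ 2) ^ (S i)) n).
    { apply sum_Rle; intros i _; apply (Hc i). }
    rewrite sum_plus.
    rewrite (sum_eq (fun i => e * (/ 2) ^ (S i)) (fun i => (/ 2) ^ (S i) * e)) by (intros; ring).
    rewrite <- scal_sum.
    specialize (Hs n); pose proof (sum_half_pow n); nra.
Qed.

Lemma outer_le_union (A B : set2) s t :
  outer_le A s -> outer_le B t -> outer_le (fun x => A x \/ B x) (s + t).
Proof.
  intros HA HB.
  apply outer_le_mono with
    (fun x => exists n, match n with 0%nat => A | 1%nat => B | _ => fun _ => False end x)
    (s + t).
  - intros x [H|H]; [exists 0%nat | exists 1%nat]; exact H.
  - lra.
  - apply outer_le_countable with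
      (fun n => match n with 0%nat => s | 1%nat => t | _ => 0 end).
    + intros [|[|n]]; [exact HA | exact HB | exact outer_le_empty].
    + pose proof (outer_le_ge0 _ _ HA); pose proof (outer_le_ge0 _ _ HB).
      intros [|n]; [simpl; lra|].
      enough (sum_f_R0 (fun n => match n with 0%nat => s | 1%nat => t | _ => 0 end) (S n)
              = s + t) by lra.
      induction n; [simpl; ring | rewrite tech5, IHn; ring].
Qed.

Definition swap (p : pt) : pt := (snd p, fst p).

Lemma swapK p : swap (swap p) = p.
Proof. destruct p; reflexivity. Qed.

Lemma outer_le_swap (A : set2) s : outer_le A s -> outer_le (fun x => A (swap x)) s.
Proof.
  intros H e He; destruct (H e He) as (rs & H1 & H2 & H3).
  exists (fun n => match rs n with (a, b, c, d) => (c, d, a, b) end); repeat split.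
  - intros n; specialize (H1 n); destruct (rs n) as [[[a b] c] d]; simpl in *; tauto.
  - intros x Hx; destruct (H2 _ Hx) as [n Hn]; exists n.
    destruct (rs n) as [[[a b] c] d]; simpl in *; tauto.
  - intros n; rewrite (sum_eq _ (fun k => rect_area (rs k))); [apply H3|].
    intros k _; destruct (rs k) as [[[a b] c] d]; simpl; ring.
Qed.

(** * The unit square has outer measure at least one *)

Definition ilen (a b u w : R) : R := Rmax 0 (Rmin b (u + w) - Rmax a u).

Ltac minmax := unfold ilen, Rmax, Rmin in *; repeat destruct (Rle_dec _ _); try lra.

Lemma ilen_ge0 a b u w : 0 <= ilen a b u w.
Proof. apply Rmax_l. Qed.

Lemma ilen_le a b u w : a <= b -> ilen a b u w <= b - a.
Proof. intros; minmax. Qed.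

Lemma ilen_split a b u w :
  a <= b -> 0 <= w -> ilen a b u w = ilen a b u (w / 2) + ilen a b (u + w / 2) (w / 2).
Proof. intros; minmax. Qed.

Lemma ilen_inside a b u w : 0 <= w -> a <= u -> u + w <= b -> ilen a b u w = w.
Proof. intros; minmax. Qed.

Definition cap (r : rect) (x y w : R) : R :=
  match r with (a, b, c, d) => ilen a b x w * ilen c d y w end.

Lemma cap_ge0 r x y w : 0 <= cap r x y w.
Proof.
  destruct r as [[[a b] c] d]; apply Rmult_le_pos; apply ilen_ge0.
Qed.

Lemma cap_le r x y w : rect_ok r -> cap r x y w <= rect_area r.
Proof.
  destruct r as [[[a b] c] d]; simpl; intros [H1 H2].
  apply Rmult_le_compat; try apply ilen_ge0; apply ilen_le; assumption.
Qed.

Lemma cap_split r x y w : rect_ok r -> 0 <= w ->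
  cap r x y w = cap r x y (w / 2) + cap r (x + w / 2) y (w / 2)
              + cap r x (y + w / 2) (w / 2) + cap r (x + w / 2) (y + w / 2) (w / 2).
Proof.
  destruct r as [[[a b] c] d]; simpl; intros [H1 H2] Hw.
  rewrite (ilen_split a b x w), (ilen_split c d y w) by assumption; ring.
Qed.

Definition interior_rect (r : rect) (x : pt) : Prop :=
  match r with (a, b, c, d) => a < fst x < b /\ c < snd x < d end.

Lemma enlarge_rect r e : rect_ok r -> 0 < e ->
  exists r', rect_ok r' /\ (forall x, in_rect r x -> interior_rect r' x) /\
    rect_area r' <= rect_area r + e.
Proof.
  destruct r as [[[a b] c] d]; simpl; intros [H1 H2] He.
  (* Moving each side out by [h] adds [2 h (b - a + d - c) + 4 h^2] to the area. The summand [e] in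
     [D] gives [h < 1], hence [4 h^2 <= 4 h] and a total increase of at most [h D = e]. *)
  set (D := 2 * (b - a + (d - c)) + 4 + e).
  assert (HD : 0 < D) by (unfold D; lra).
  set (h := e / D).
  assert (Hh : 0 < h) by (apply Rdiv_lt_0_compat; lra).
  assert (Hh1 : h * D = e) by (unfold h; field; lra).
  assert (Hh2 : h < 1) by (unfold D in *; nra).
  exists (a - h, b + h, c - h, d + h); simpl; repeat split; try lra.
  unfold D in *; nra.
Qed.

Section Bisection.

Variable rs : nat -> rect.
Hypothesis rs_ok : forall n, rect_ok (rs n).

(** The bound [c] is uniform in [n] and strictly below the area of the cell; part of this deficit
    survives in some quarter. *)
Definition undercovered (x y w : R) : Prop :=
  exists c, c < w * w /\ forall n, sum_f_R0 (fun k => cap (rs k) x y w) n <= c.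

Lemma not_undercovered x y w c : ~ undercovered x y w -> c < w * w ->
  exists n, c < sum_f_R0 (fun k => cap (rs k) x y w) n.
Proof.
  intros H Hc; apply NNPP; intros Hn; apply H; exists c; split; [exact Hc|].
  intros n; apply Rnot_lt_le; intros Hlt; apply Hn; exists n; exact Hlt.
Qed.

Lemma undercovered_split x y w : 0 <= w -> undercovered x y w ->
  exists x' y', (x <= x' <= x + w / 2) /\ (y <= y' <= y + w / 2) /\
    undercovered x' y' (w / 2).
Proof.
  intros Hw (c & Hc & Hs); apply NNPP; intros Hno.
  (* If each quarter missed less than an eighth of the deficit [w * w - c], the four partial sums
     together would exceed [c]. *)
  assert (Hq : forall x' y', (x <= x' <= x + w / 2) -> (y <= y' <= y + w / 2) ->
    exists n, w / 2 * (w / 2) - (w * w - c) / 8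
              < sum_f_R0 (fun k => cap (rs k) x' y' (w / 2)) n).
  { intros x' y' Hx Hy; apply not_undercovered; [|lra].
    intros Hu; apply Hno; exists x', y'; tauto. }
  destruct (Hq x y) as [n1 H1]; try lra.
  destruct (Hq (x + w / 2) y) as [n2 H2]; try lra.
  destruct (Hq x (y + w / 2)) as [n3 H3]; try lra.
  destruct (Hq (x + w / 2) (y + w / 2)) as [n4 H4]; try lra.
  set (n := (n1 + n2 + n3 + n4)%nat).
  assert (Hup : forall x' y' m, (m <= n)%nat ->
    sum_f_R0 (fun k => cap (rs k) x' y' (w / 2)) m
    <= sum_f_R0 (fun k => cap (rs k) x' y' (w / 2)) n).
  { intros; apply sum_le_index; [intros; apply cap_ge0 | assumption]. }
  pose proof (Hup x y n1 ltac:(lia)).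
  pose proof (Hup (x + w / 2) y n2 ltac:(lia)).
  pose proof (Hup x (y + w / 2) n3 ltac:(lia)).
  pose proof (Hup (x + w / 2) (y + w / 2) n4 ltac:(lia)).
  specialize (Hs n).
  rewrite (sum_eq _ (fun k => cap (rs k) x y (w / 2) + cap (rs k) (x + w / 2) y (w / 2)
     + cap (rs k) x (y + w / 2) (w / 2) + cap (rs k) (x + w / 2) (y + w / 2) (w / 2))) in Hs
    by (intros; apply cap_split; auto).
  rewrite !sum_plus in Hs.
  lra.
Qed.

(** The default branch halves the width too, so that [cells_width] holds unconditionally. *)
Definition next_cell (c : R * R * R) : R * R * R :=
  match c with (x, y, w) =>
    match excluded_middle_informative (0 <= w /\ undercovered x y w) with
    | left H =>
        let e := constructive_indefinite_description _
                   (undercovered_split x y w (proj1 H) (proj2 H)) in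
        let e' := constructive_indefinite_description _ (proj2_sig e) in
        (proj1_sig e, proj1_sig e', w / 2)
    | right _ => (x, y, w / 2)
    end
  end.

Fixpoint cells (n : nat) : R * R * R :=
  match n with O => (0, 0, 1) | S n => next_cell (cells n) end.

Definition cx n := fst (fst (cells n)).
Definition cy n := snd (fst (cells n)).

Lemma cells_width n : snd (cells n) = (/ 2) ^ n.
Proof.
  induction n; simpl; [reflexivity|].
  rewrite <- IHn; destruct (cells n) as [[x y] w]; simpl.
  destruct (excluded_middle_informative _); simpl; lra.
Qed.

Lemma cells_step n : undercovered (cx n) (cy n) ((/ 2) ^ n) ->
  (cx n <= cx (S n) <= cx n + (/ 2) ^ n / 2) /\
  (cy n <= cy (S n) <= cy n + (/ 2) ^ n / 2) /\
  undercovered (cx (S n)) (cy (S n)) ((/ 2) ^ (S n)).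
Proof.
  pose proof (cells_width n) as Hw.
  pose proof (pow_lt (/ 2) n ltac:(lra)) as Hp.
  unfold cx, cy; simpl; destruct (cells n) as [[x y] w]; simpl in *; subst w.
  intros Hu; destruct (excluded_middle_informative _) as [H|H]; [|exfalso; apply H; split; [lra | exact Hu]].
  simpl.
  destruct (constructive_indefinite_description _ _) as [x' Hx']; simpl.
  destruct (constructive_indefinite_description _ _) as [y' Hy']; simpl.
  replace (/ 2 * (/ 2) ^ n) with ((/ 2) ^ n / 2) by lra.
  exact Hy'.
Qed.

Lemma cells_undercovered n : undercovered 0 0 1 -> undercovered (cx n) (cy n) ((/ 2) ^ n).
Proof.
  intros H; induction n; [exact H|].
  apply cells_step, IHn.
Qed.

Lemma nested_point (u : nat -> R) :
  (forall n, u n <= u (S n) <= u n + (/ 2) ^ n / 2) ->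
  exists X, forall n, u n <= X <= u n + (/ 2) ^ n.
Proof.
  intros Hu.
  assert (Hmono : forall n m, u n <= u (m + n)%nat).
  { intros n m; induction m; simpl; [lra|]; specialize (Hu (m + n)%nat); lra. }
  assert (Hdec : forall n m, u (m + n)%nat + (/ 2) ^ (m + n) <= u n + (/ 2) ^ n).
  { intros n m; induction m; simpl; [lra|]; specialize (Hu (m + n)%nat); lra. }
  assert (Hle : forall n m, u m <= u n + (/ 2) ^ n).
  { intros n m; pose proof (Hmono m n) as H1; pose proof (Hdec n m) as H2.
    rewrite Nat.add_comm in H2.
    pose proof (pow_lt (/ 2) (n + m) ltac:(lra)); lra. }
  destruct (completeness (fun z => exists n, z = u n)) as [X [HX1 HX2]].
  - exists (u 0%nat + (/ 2) ^ 0); intros z [n ->]; apply Hle.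
  - exists (u 0%nat), 0%nat; reflexivity.
  - exists X; intros n; split.
    + apply HX1; exists n; reflexivity.
    + apply HX2; intros z [m ->]; apply Hle.
Qed.

Lemma pow_half_small d : 0 < d -> exists n, (/ 2) ^ n < d.
Proof.
  intros Hd; destruct (pow_lt_1_zero (/ 2)) with d as [N HN]; auto.
  { rewrite Rabs_right; lra. }
  exists N; specialize (HN N (le_n N)).
  rewrite Rabs_right in HN; [exact HN|].
  apply Rle_ge, pow_le; lra.
Qed.

(** Compactness by bisection: the undercovered cells shrink to a point, and a rectangle with this
    point in its interior would contain one of the cells and cover it fully. *)
Lemma undercovered_not_covered : undercovered 0 0 1 ->
  exists x, square x /\ forall n, ~ interior_rect (rs n) x.
Proof.
  intros H.
  assert (Hu := fun n => cells_undercovered n H).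
  destruct (nested_point cx) as [X HX].
  { intros n; apply cells_step, Hu. }
  destruct (nested_point cy) as [Y HY].
  { intros n; apply cells_step, Hu. }
  exists (X, Y); split.
  { pose proof (HX 0%nat) as H1; pose proof (HY 0%nat) as H2.
    unfold cx, cy in H1, H2; simpl in H1, H2; split; simpl; lra. }
  intros k Hk; pose proof (rs_ok k) as Hok.
  destruct (rs k) as [[[a b] c] d] eqn:Er; simpl in Hk.
  destruct (pow_half_small (Rmin (Rmin (X - a) (b - X)) (Rmin (Y - c) (d - Y)))) as [n Hn].
  { minmax. }
  destruct (Hu n) as (s & Hs & Hsum).
  specialize (Hsum k); specialize (HX n); specialize (HY n).
  assert (Hc : cap (rs k) (cx n) (cy n) ((/ 2) ^ n) = (/ 2) ^ n * (/ 2) ^ n).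
  { rewrite Er; simpl; pose proof (pow_lt (/ 2) n ltac:(lra)) as Hp.
    set (w := (/ 2) ^ n) in *; clearbody w.
    rewrite !ilen_inside; minmax. }
  pose proof (sum_term_le (fun k => cap (rs k) (cx n) (cy n) ((/ 2) ^ n)) k k
    (fun j => cap_ge0 _ _ _ _) (le_n k)) as Hle; simpl in Hle.
  lra.
Qed.

End Bisection.

Lemma outer_le_square_ge1 s : outer_le square s -> 1 <= s.
Proof.
  intros H; apply Rnot_lt_le; intros Hs.
  (* One [e] pays for the slack of the cover and one for enlarging its rectangles; the total
     [s + 2 e] is still below 1. *)
  set (e := (1 - s) / 4).
  assert (He : 0 < e) by (unfold e; lra).
  destruct (H e He) as (rs & H1 & H2 & H3).
  assert (He' : forall n, 0 < e * (/ 2) ^ (S n)).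
  { intros n; apply Rmult_lt_0_compat; [exact He | apply pow_lt; lra]. }
  set (r' := fun n => proj1_sig
     (constructive_indefinite_description _ (enlarge_rect (rs n) _ (H1 n) (He' n)))).
  assert (Hr' : forall n, rect_ok (r' n) /\
      (forall x, in_rect (rs n) x -> interior_rect (r' n) x) /\
      rect_area (r' n) <= rect_area (rs n) + e * (/ 2) ^ (S n)).
  { intros n; unfold r'.
    exact (proj2_sig (constructive_indefinite_description _
            (enlarge_rect (rs n) _ (H1 n) (He' n)))). }
  destruct (undercovered_not_covered r') as (x & Hx & Hn).
  - intros n; apply Hr'.
  - exists (s + e + e); split; [unfold e; lra|].
    intros n.
    apply Rle_trans with (sum_f_R0 (fun k => rect_area (rs k) + e * (/ 2) ^ (S k)) n).
    { apply sum_Rle; intros k _; destruct (Hr' k) as (Hok & _ & Ha).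
      pose proof (cap_le (r' k) 0 0 1 Hok); lra. }
    rewrite sum_plus, (sum_eq (fun i => e * (/ 2) ^ (S i)) (fun i => (/ 2) ^ (S i) * e)) by (intros; ring).
    rewrite <- scal_sum.
    specialize (H3 n); pose proof (sum_half_pow n); nra.
  - destruct (H2 x Hx) as [n Hin]; apply (Hn n), Hr', Hin.
Qed.

(** * Regions between two Lipschitz graphs *)

Definition between (l r : R -> R) (y0 h : R) : set2 :=
  fun p => y0 <= snd p <= y0 + h /\ l (snd p) <= fst p <= r (snd p).

(* Halving the strip in [y] halves the error [c h^2] of the bounding-box estimate. *)
Lemma outer_le_between_err (l r : R -> R) c w0 w1 k : forall y0 h, 0 <= h ->
  (forall y y', y0 <= y <= y0 + h -> y0 <= y' <= y0 + h -> Rabs (l y - l y') <= c * Rabs (y - y')) ->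
  (forall y y', y0 <= y <= y0 + h -> y0 <= y' <= y0 + h -> Rabs (r y - r y') <= c * Rabs (y - y')) ->
  (forall y, y0 <= y <= y0 + h -> l y <= r y <= l y + (w0 + w1 * y)) ->
  0 <= c ->
  outer_le (between l r y0 h) (h * (w0 + w1 * (y0 + h / 2)) + c * h * h * (/ 2) ^ k).
Proof.
  induction k as [|k IH]; intros y0 h Hh Hl Hr Hw Hc.
  - set (ym := y0 + h / 2).
    assert (Hym : y0 <= ym <= y0 + h) by (unfold ym; lra).
    pose proof (Hw ym Hym) as Hwm.
    apply outer_le_mono with
      (in_rect (l ym - c * h / 2, r ym + c * h / 2, y0, y0 + h))
      (rect_area (l ym - c * h / 2, r ym + c * h / 2, y0, y0 + h)).
    + intros p [Hp1 Hp2]; simpl; split; [|exact Hp1].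
      pose proof (Hl _ _ Hp1 Hym) as H1; pose proof (Hr _ _ Hp1 Hym) as H2.
      assert (Hd : Rabs (snd p - ym) <= h / 2) by (unfold ym; apply Rabs_le; lra).
      assert (Hcd : c * Rabs (snd p - ym) <= c * (h / 2)) by (apply Rmult_le_compat_l; lra).
      pose proof (Rle_abs (l ym - l (snd p))); pose proof (Rle_abs (r (snd p) - r ym)).
      rewrite Rabs_minus_sym in H1; lra.
    + simpl; fold ym; nra.
    + apply outer_le_rect; simpl; assert (0 <= c * h) by (apply Rmult_le_pos; lra); lra.
  - apply outer_le_mono with
      (fun p => between l r y0 (h / 2) p \/ between l r (y0 + h / 2) (h / 2) p)
      ((h / 2 * (w0 + w1 * (y0 + h / 2 / 2)) + c * (h / 2) * (h / 2) * (/ 2) ^ k) +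
       (h / 2 * (w0 + w1 * (y0 + h / 2 + h / 2 / 2)) + c * (h / 2) * (h / 2) * (/ 2) ^ k)).
    + intros p [Hp1 Hp2]; destruct (Rle_dec (snd p) (y0 + h / 2));
        [left | right]; split; try exact Hp2; lra.
    + simpl; lra.
    + apply outer_le_union; apply IH; try lra; intros.
      * apply Hl; lra.
      * apply Hr; lra.
      * apply Hw; lra.
      * apply Hl; lra.
      * apply Hr; lra.
      * apply Hw; lra.
Qed.

(** Letting [k] grow removes the error of the bounding boxes. What remains is the height times the
    width at mid-height, which is the exact integral of an affine width. *)
Lemma outer_le_between (l r : R -> R) c w0 w1 y0 h : 0 <= h ->
  (forall y y', y0 <= y <= y0 + h -> y0 <= y' <= y0 + h -> Rabs (l y - l y') <= c * Rabs (y - y')) ->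
  (forall y y', y0 <= y <= y0 + h -> y0 <= y' <= y0 + h -> Rabs (r y - r y') <= c * Rabs (y - y')) ->
  (forall y, y0 <= y <= y0 + h -> l y <= r y <= l y + (w0 + w1 * y)) ->
  0 <= c ->
  outer_le (between l r y0 h) (h * (w0 + w1 * (y0 + h / 2))).
Proof.
  intros Hh Hl Hr Hw Hc; apply outer_le_closed; intros e He.
  assert (HM : 0 <= c * h * h) by (repeat apply Rmult_le_pos; lra).
  destruct (pow_half_small (e / (c * h * h + 1))) as [k Hk].
  { apply Rdiv_lt_0_compat; lra. }
  eapply outer_le_mono; [intros x Hx; exact Hx | | apply (outer_le_between_err l r c w0 w1 k); auto].
  assert (c * h * h * (/ 2) ^ k <= (c * h * h + 1) * (e / (c * h * h + 1))).
  { apply Rmult_le_compat; try lra; apply pow_le; lra. }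
  replace ((c * h * h + 1) * (e / (c * h * h + 1))) with e in H by (field; lra).
  lra.
Qed.

(** * Energies of a quadtree *)

(* A cell is split in the order: bottom left, bottom right, top left, top right. *)
Inductive qtree : Type :=
  | Leaf : bool -> qtree
  | Node : qtree -> qtree -> qtree -> qtree -> qtree.

Definition b2R (b : bool) : R := if b then 1 else 0.

Fixpoint mean (T : qtree) : R :=
  match T with
  | Leaf b => b2R b
  | Node a b c d => (mean a + mean b + mean c + mean d) / 4
  end.

(* [ymom T] is the integral of [y - 1/2] over the region described by [T]. *)
Fixpoint ymom (T : qtree) : R :=
  match T with
  | Leaf _ => 0
  | Node a b c d =>
      (mean c + mean d - mean a - mean b) / 16 + (ymom a + ymom b + ymom c + ymom d) / 8
  end.

(* [alpha] is the Haar coefficient and [coef] the coefficient against the [x]-derivative of the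
   pyramid, whose sign is that of the Haar function and whose modulus is [2 min(2y, 2 - 2y)]. *)
Definition alpha (a b c d : qtree) : R := (mean a - mean b + mean c - mean d) / 4.

Definition coef (a b c d : qtree) : R :=
  alpha a b c d + (ymom a - ymom b - ymom c + ymom d) / 2.

Fixpoint haar_energy (T : qtree) : R :=
  match T with
  | Leaf _ => 0
  | Node a b c d =>
      alpha a b c d ^ 2
      + (haar_energy a + haar_energy b + haar_energy c + haar_energy d) / 4
  end.

Fixpoint bump_energy (T : qtree) : R :=
  match T with
  | Leaf _ => 0
  | Node a b c d =>
      coef a b c d ^ 2
      + (bump_energy a + bump_energy b + bump_energy c + bump_energy d) / 4
  end.

Lemma mean_bounds T : 0 <= mean T <= 1.
Proof. induction T as [b|]; simpl; [destruct b; simpl|]; lra. Qed.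

Lemma ymom_bounds T :
  - mean T / 2 <= ymom T <= mean T / 2 /\ -(1 - mean T) / 2 <= ymom T <= (1 - mean T) / 2.
Proof. induction T as [b|]; simpl; [destruct b; simpl|]; lra. Qed.

Lemma coef_bounds a b c d : - (1 / 2) <= coef a b c d <= 1 / 2.
Proof.
  unfold coef, alpha.
  pose proof (mean_bounds a); pose proof (mean_bounds b).
  pose proof (mean_bounds c); pose proof (mean_bounds d).
  pose proof (ymom_bounds a); pose proof (ymom_bounds b).
  pose proof (ymom_bounds c); pose proof (ymom_bounds d).
  lra.
Qed.

(* The right side is [\int (f - c - d (y - 1/2))^2]; the induction needs all [c] and [d] since the
   bumps of a cell restrict to affine functions of [y] on its quarters. *)
Lemma bump_bessel T : forall c d,
  3 / 4 * bump_energy T <= mean T - 2 * c * mean T - 2 * d * ymom T + c ^ 2 + d ^ 2 / 12.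
Proof.
  induction T as [b|T1 H1 T2 H2 T3 H3 T4 H4]; intros c d; simpl bump_energy; simpl mean; simpl ymom.
  - pose proof (pow2_ge_0 (b2R b - c)); pose proof (pow2_ge_0 d); destruct b; simpl in *; lra.
  - set (w := coef T1 T2 T3 T4).
    (* The derivative of the pyramid has squared norm 4/3, so the projection of [f] on it has
       coefficient [3/4 w]. These are the restrictions of [c + d (y - 1/2)] plus that projection to
       the four quarters. *)
    specialize (H1 (c - d / 4 + 3 / 4 * w) (d / 2 + 3 / 2 * w)).
    specialize (H2 (c - d / 4 - 3 / 4 * w) (d / 2 - 3 / 2 * w)).
    specialize (H3 (c + d / 4 + 3 / 4 * w) (d / 2 - 3 / 2 * w)).
    specialize (H4 (c + d / 4 - 3 / 4 * w) (d / 2 + 3 / 2 * w)).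
    assert (Hw : w * (mean T1 - mean T2 + mean T3 - mean T4
                 + 2 * (ymom T1 - ymom T2 - ymom T3 + ymom T4)) = 4 * w ^ 2).
    { unfold w, coef, alpha; field. }
    lra.
Qed.

Lemma bump_energy_le T : bump_energy T <= 4 / 3.
Proof. pose proof (bump_bessel T 0 0); pose proof (mean_bounds T); lra. Qed.

(** The difference [w - al] of the two coefficients is half the mixed moment of the quarters.
    Changing the slopes on the quarters by [6 al], with alternating signs, therefore lowers the
    squared distance to [f] by [3 al^2 - 6 al w], which is at least [5/2 al^2 - 18 w^2] because
    [(al - 6 w)^2 >= 0]. *)
Lemma haar_le_bump T : forall c d,
  0 <= mean T - 2 * c * mean T - 2 * d * ymom T + c ^ 2 + d ^ 2 / 12
       - 5 / 2 * haar_energy T + 18 * bump_energy T.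
Proof.
  induction T as [b|T1 H1 T2 H2 T3 H3 T4 H4]; intros c d;
    simpl bump_energy; simpl haar_energy; simpl mean; simpl ymom.
  - pose proof (pow2_ge_0 (b2R b - c)); pose proof (pow2_ge_0 d); destruct b; simpl in *; lra.
  - set (w := coef T1 T2 T3 T4); set (al := alpha T1 T2 T3 T4).
    specialize (H1 (c - d / 4) (d / 2 - 6 * al)).
    specialize (H2 (c - d / 4) (d / 2 + 6 * al)).
    specialize (H3 (c + d / 4) (d / 2 + 6 * al)).
    specialize (H4 (c + d / 4) (d / 2 - 6 * al)).
    assert (Hw : al * (ymom T1 - ymom T2 - ymom T3 + ymom T4) = 2 * al * (w - al)).
    { unfold w, coef; fold al; field. }
    pose proof (pow2_ge_0 (al - 6 * w)).
    lra.
Qed.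

(* [bottom T] and [top T] describe the lower and upper half of the cell, stretched vertically by
   a factor two: the dyadic cells of these trees are the 2:1 rectangles of the original one. *)
Fixpoint bottom (T : qtree) : qtree :=
  match T with
  | Leaf b => Leaf b
  | Node a b c d => Node (bottom a) (bottom b) (top a) (top b)
  end
with top (T : qtree) : qtree :=
  match T with
  | Leaf b => Leaf b
  | Node a b c d => Node (bottom c) (bottom d) (top c) (top d)
  end.

Fixpoint transpose (T : qtree) : qtree :=
  match T with
  | Leaf b => Leaf b
  | Node a b c d => Node (transpose a) (transpose c) (transpose b) (transpose d)
  end.

Lemma mean_bottom_top T : mean (bottom T) + mean (top T) = 2 * mean T.
Proof. induction T; simpl; lra. Qed.

Lemma mean_transpose T : mean (transpose T) = mean T.
Proof. induction T; simpl; lra. Qed.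

Definition xenergy (T : qtree) : R := (haar_energy (bottom T) + haar_energy (top T)) / 2.

(** A subdivision adds the variance of the four quarter means. It is 1/8 of the sum of the squared
    differences of adjacent quarters, minus 1/16 of the square of the mixed difference. Horizontally
    adjacent quarters give the Haar coefficients of [T], vertically adjacent ones those of the
    transpose. *)
Lemma variance_le_energy T :
  mean T - mean T ^ 2 <= xenergy T + xenergy (transpose T).
Proof.
  unfold xenergy; induction T as [b|T1 H1 T2 H2 T3 H3 T4 H4].
  - destruct b; simpl; lra.
  - cbn [bottom top transpose haar_energy mean]; unfold alpha.
    pose proof (mean_bottom_top T1) as E1; pose proof (mean_bottom_top T2) as E2.
    pose proof (mean_bottom_top T3) as E3; pose proof (mean_bottom_top T4) as E4.
    pose proof (mean_bottom_top (transpose T1)) as F1; pose proof (mean_bottom_top (transpose T2)) as F2.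
    pose proof (mean_bottom_top (transpose T3)) as F3; pose proof (mean_bottom_top (transpose T4)) as F4.
    rewrite mean_transpose in F1, F2, F3, F4.
    replace (mean (top T1)) with (2 * mean T1 - mean (bottom T1)) by lra.
    replace (mean (top T2)) with (2 * mean T2 - mean (bottom T2)) by lra.
    replace (mean (top T3)) with (2 * mean T3 - mean (bottom T3)) by lra.
    replace (mean (top T4)) with (2 * mean T4 - mean (bottom T4)) by lra.
    replace (mean (top (transpose T1))) with (2 * mean T1 - mean (bottom (transpose T1))) by lra.
    replace (mean (top (transpose T2))) with (2 * mean T2 - mean (bottom (transpose T2))) by lra.
    replace (mean (top (transpose T3))) with (2 * mean T3 - mean (bottom (transpose T3))) by lra.
    replace (mean (top (transpose T4))) with (2 * mean T4 - mean (bottom (transpose T4))) by lra.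
    pose proof (pow2_ge_0 (mean T1 - mean T2 - mean T3 + mean T4)).
    lra.
Qed.

Definition xgain (T : qtree) : R := (bump_energy (bottom T) + bump_energy (top T)) / 2.

Lemma xgain_lower T : (mean T - mean T ^ 2) / 2 <= xenergy T ->
  (mean T - mean T ^ 2) / 72 <= xgain T.
Proof.
  unfold xgain, xenergy; intros H.
  (* Averaged over the two halves, this reads [0 <= Var - 5/2 xenergy + 18 xgain]; the hypothesis
     then leaves [18 xgain >= Var / 4]. *)
  pose proof (haar_le_bump (bottom T) (mean T) 0); pose proof (haar_le_bump (top T) (mean T) 0).
  pose proof (mean_bottom_top T) as E.
  replace (mean (top T)) with (2 * mean T - mean (bottom T)) in * by lra.
  lra.
Qed.

Lemma xgain_or_transpose T :
  (mean T - mean T ^ 2) / 72 <= xgain T \/ (mean T - mean T ^ 2) / 72 <= xgain (transpose T).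
Proof.
  pose proof (variance_le_energy T) as H.
  destruct (Rle_dec ((mean T - mean T ^ 2) / 2) (xenergy T)) as [Hx|Hx].
  - left; apply xgain_lower, Hx.
  - right; rewrite <- (mean_transpose T); apply xgain_lower; rewrite mean_transpose; lra.
Qed.

(** * The stopped bump series *)

(* [Pol A B C D] is the bilinear function [A + B u + C v + D u v] of the
   coordinates [u = x - 1/2], [v = y - 1/2] centred in the cell. *)
Record bilin : Type := Pol { pA : R; pB : R; pC : R; pD : R }.

Definition bev (p : bilin) (x y : R) : R :=
  pA p + pB p * (x - 1 / 2) + pC p * (y - 1 / 2) + pD p * (x - 1 / 2) * (y - 1 / 2).

(* The restriction to the quarter [(s, t)], [s, t = -1] or [1], of the polynomial plus [a]
   times the pyramid of the cell; the quarter is rescaled to a unit cell and the values are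
   doubled, which preserves gradients. *)
Definition child (s t a : R) (p : bilin) : bilin :=
  Pol (2 * pA p + pB p * s / 2 + pC p * t / 2 + pD p * s * t / 8 + a / 2)
      (pB p + t * pD p / 4 - a * s)
      (pC p + s * pD p / 4 - a * t)
      (pD p / 2 + 2 * a * s * t).

(* A quadtree whose nodes carry the height of the pyramid placed on the cell. *)
Inductive dtree : Type :=
  | DLeaf : bool -> dtree
  | DNode : R -> dtree -> dtree -> dtree -> dtree -> dtree.

Fixpoint shape (T : dtree) : qtree :=
  match T with
  | DLeaf b => Leaf b
  | DNode _ a b c d => Node (shape a) (shape b) (shape c) (shape d)
  end.

(** The integral of the [x]-derivative of the field over the region of the tree. At a leaf [pD]
    drops out, since [y - 1/2] has mean zero. *)
Fixpoint dgain (T : dtree) (p : bilin) : R :=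
  match T with
  | DLeaf f => b2R f * pB p
  | DNode w a b c d =>
      (dgain a (child (-1) (-1) w p) + dgain b (child 1 (-1) w p)
       + dgain c (child (-1) 1 w p) + dgain d (child 1 1 w p)) / 4
  end.

(** On a leaf the partial derivatives are [B + D v] and [C + D u] with [u] and [v] of modulus at
    most 1/2, so [L] bounds both. *)
Fixpoint steep_le (T : dtree) (L : R) (p : bilin) : Prop :=
  match T with
  | DLeaf _ => Rabs (pB p) + Rabs (pD p) / 2 <= L /\ Rabs (pC p) + Rabs (pD p) / 2 <= L
  | DNode w a b c d =>
      steep_le a L (child (-1) (-1) w p) /\ steep_le b L (child 1 (-1) w p) /\
      steep_le c L (child (-1) 1 w p) /\ steep_le d L (child 1 1 w p)
  end.

Fixpoint frozen (T : qtree) : dtree :=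
  match T with
  | Leaf b => DLeaf b
  | Node a b c d => DNode 0 (frozen a) (frozen b) (frozen c) (frozen d)
  end.

Lemma shape_frozen T : shape (frozen T) = T.
Proof. induction T; simpl; congruence. Qed.

Lemma dgain_frozen T : forall p, dgain (frozen T) p = pB p * mean T + pD p * ymom T.
Proof.
  induction T as [b|T1 H1 T2 H2 T3 H3 T4 H4]; intros p; simpl.
  - ring.
  - rewrite H1, H2, H3, H4; simpl; field.
Qed.

Ltac cases_abs := unfold Rabs in *; repeat destruct (Rcase_abs _); lra.

Lemma steep_frozen T L : forall p,
  Rabs (pB p) + Rabs (pD p) / 2 <= L -> Rabs (pC p) + Rabs (pD p) / 2 <= L ->
  steep_le (frozen T) L p.
Proof.
  induction T as [b|T1 H1 T2 H2 T3 H3 T4 H4]; intros p HB HC; simpl.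
  - tauto.
  - destruct p as [A B C D]; simpl in HB, HC.
    repeat split; [apply H1 | apply H2 | apply H3 | apply H4]; simpl; clear - HB HC; cases_abs.
Qed.

(** The mean of the squared gradient over the unit cell. *)
Definition size2 (p : bilin) : R := pB p ^ 2 + pC p ^ 2 + pD p ^ 2 / 6.

Fixpoint stopped (T : qtree) (p : bilin) : dtree :=
  match T with
  | Leaf b => DLeaf b
  | Node a b c d =>
      if Rlt_dec (size2 p) 4 then
        let w := coef a b c d in
        DNode w (stopped a (child (-1) (-1) w p)) (stopped b (child 1 (-1) w p))
                (stopped c (child (-1) 1 w p)) (stopped d (child 1 1 w p))
      else frozen T
  end.

Lemma shape_stopped T : forall p, shape (stopped T p) = T.
Proof.
  induction T as [b|T1 H1 T2 H2 T3 H3 T4 H4]; intros p; cbn [stopped]; [reflexivity|].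
  destruct (Rlt_dec _ _).
  - simpl; rewrite H1, H2, H3, H4; reflexivity.
  - apply shape_frozen.
Qed.

Lemma sqr_lt_bound x : x ^ 2 < 4 -> Rabs x < 2.
Proof. intros H; unfold Rabs; destruct (Rcase_abs x); nra. Qed.

(** The three bounds are invariant: where a pyramid is added, [|B|, |C| < 2] and [|w| <= 1/2], so
    the new slopes are at most [2 + 2/4 + 1/2 = 3] and the new [|D|] at most [2/2 + 2/2 = 2].
    Wherever the process ends, the steepness is at most [3 + 2/2 = 4]. *)
Lemma steep_stopped T : forall p,
  Rabs (pB p) <= 3 -> Rabs (pC p) <= 3 -> Rabs (pD p) <= 2 -> steep_le (stopped T p) 4 p.
Proof.
  induction T as [b|T1 H1 T2 H2 T3 H3 T4 H4]; intros p HB HC HD; cbn [stopped].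
  - simpl; lra.
  - destruct (Rlt_dec _ _) as [Hs|Hs]; [|apply steep_frozen; lra].
    pose proof (coef_bounds T1 T2 T3 T4) as Hw; set (w := coef T1 T2 T3 T4) in *; clearbody w.
    destruct p as [A B C D]; unfold size2 in Hs; simpl pB in *; simpl pC in *; simpl pD in *.
    pose proof (pow2_ge_0 B); pose proof (pow2_ge_0 C); pose proof (pow2_ge_0 D).
    pose proof (sqr_lt_bound B ltac:(lra)) as HB'; pose proof (sqr_lt_bound C ltac:(lra)) as HC'.
    simpl; repeat split; [apply H1 | apply H2 | apply H3 | apply H4]; simpl;
      clear - Hw HB' HC' HD; cases_abs.
Qed.

(* A stopped cell loses at most [4/3] of energy per unit area, while it carries [size2 >= 4]; and
   [size2] averages to [size2 p + 8/3 w^2] over the four quarters of a cell. *)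
Lemma dgain_stopped T : forall p,
  bump_energy T <= 2 * (dgain (stopped T p) p - pB p * mean T - pD p * ymom T) + size2 p / 3.
Proof.
  induction T as [b|T1 H1 T2 H2 T3 H3 T4 H4]; intros p; cbn [stopped].
  - simpl; unfold size2.
    pose proof (pow2_ge_0 (pB p)); pose proof (pow2_ge_0 (pC p)); pose proof (pow2_ge_0 (pD p)); lra.
  - destruct (Rlt_dec _ _) as [Hs|Hs].
    + cbn [dgain bump_energy mean ymom].
      set (w := coef T1 T2 T3 T4).
      specialize (H1 (child (-1) (-1) w p)); specialize (H2 (child 1 (-1) w p)).
      specialize (H3 (child (-1) 1 w p)); specialize (H4 (child 1 1 w p)).
      assert (Hw : w * (mean T1 - mean T2 + mean T3 - mean T4
                 + 2 * (ymom T1 - ymom T2 - ymom T3 + ymom T4)) = 4 * w ^ 2).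
      { unfold w, coef, alpha; field. }
      (* The pyramid contributes [w^2] to the gain, counted twice; this pays for the new energy
         [w^2] and for the increase [8/9 w^2] of [size2 / 3]. *)
      pose proof (pow2_ge_0 w).
      unfold size2 in *; simpl pB in *; simpl pC in *; simpl pD in *.
      lra.
    + rewrite dgain_frozen; pose proof (bump_energy_le (Node T1 T2 T3 T4)); lra.
Qed.

Definition pzero : bilin := Pol 0 0 0 0.

Definition bumps (T : qtree) : dtree := stopped T pzero.

Lemma dgain_bumps T : bump_energy T / 2 <= dgain (bumps T) pzero.
Proof.
  pose proof (dgain_stopped T pzero) as H; unfold size2 in H; simpl in H.
  unfold bumps; lra.
Qed.

Lemma steep_bumps T : steep_le (bumps T) 4 pzero.
Proof. apply steep_stopped; simpl; rewrite Rabs_R0; lra. Qed.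

(** * The displacement field *)

Fixpoint in_tree (T : qtree) (x y : R) : Prop :=
  match T with
  | Leaf f => f = true
  | Node a b c d =>
      if Rlt_dec x (1 / 2) then
        if Rlt_dec y (1 / 2) then in_tree a (2 * x) (2 * y) else in_tree c (2 * x) (2 * y - 1)
      else
        if Rlt_dec y (1 / 2) then in_tree b (2 * x - 1) (2 * y) else in_tree d (2 * x - 1) (2 * y - 1)
  end.

Fixpoint bump_field (T : dtree) (p : bilin) (x y : R) : R :=
  match T with
  | DLeaf _ => bev p x y
  | DNode w a b c d =>
      if Rlt_dec x (1 / 2) then
        if Rlt_dec y (1 / 2) then / 2 * bump_field a (child (-1) (-1) w p) (2 * x) (2 * y)
        else / 2 * bump_field c (child (-1) 1 w p) (2 * x) (2 * y - 1)
      else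
        if Rlt_dec y (1 / 2) then / 2 * bump_field b (child 1 (-1) w p) (2 * x - 1) (2 * y)
        else / 2 * bump_field d (child 1 1 w p) (2 * x - 1) (2 * y - 1)
  end.

(** Every pyramid vanishes on the boundary of its cell. Neighbouring quarters hence agree on their
    common side, which makes the field continuous. *)
Lemma bump_field_boundary T : forall p x y, 0 <= x <= 1 -> 0 <= y <= 1 ->
  x = 0 \/ x = 1 \/ y = 0 \/ y = 1 -> bump_field T p x y = bev p x y.
Proof.
  induction T as [f|w a IHa b IHb c IHc d IHd]; intros p x y Hx Hy Hb; simpl; [reflexivity|].
  destruct (Rlt_dec x (1 / 2)); destruct (Rlt_dec y (1 / 2));
    [rewrite IHa | rewrite IHc | rewrite IHb | rewrite IHd]; try lra;
    destruct Hb as [-> | [-> | [-> | ->]]]; try lra; unfold bev, child; simpl; field.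
Qed.

Definition lip01 (L : R) (f : R -> R) : Prop :=
  forall x x', 0 <= x <= 1 -> 0 <= x' <= 1 -> Rabs (f x - f x') <= L * Rabs (x - x').

Lemma lip01_sym_le L f :
  (forall x x', 0 <= x -> x <= x' -> x' <= 1 -> Rabs (f x - f x') <= L * (x' - x)) -> lip01 L f.
Proof.
  intros H x x' Hx Hx'; destruct (Rle_dec x x') as [Hle|Hle].
  - rewrite (Rabs_minus_sym x x'), (Rabs_right (x' - x)) by lra; apply H; lra.
  - rewrite Rabs_minus_sym, (Rabs_right (x - x')) by lra; apply H; lra.
Qed.

Lemma lip01_le L f x x' : lip01 L f -> 0 <= x -> x <= x' -> x' <= 1 ->
  Rabs (f x - f x') <= L * (x' - x).
Proof.
  intros H Hx Hle Hx'; specialize (H x x' ltac:(lra) ltac:(lra)).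
  rewrite (Rabs_minus_sym x x'), (Rabs_right (x' - x)) in H by lra; exact H.
Qed.

(** Halving both the argument and the value keeps the slope; the matching value at the junction lets
    the two pieces be chained. *)
Lemma lip01_glue L f g : lip01 L f -> lip01 L g -> f 1 = g 0 ->
  lip01 L (fun x => if Rlt_dec x (1 / 2) then / 2 * f (2 * x) else / 2 * g (2 * x - 1)).
Proof.
  intros Hf Hg Hfg; apply lip01_sym_le; intros x x' Hx Hle Hx'.
  destruct (Rlt_dec x (1 / 2)); destruct (Rlt_dec x' (1 / 2)); try lra.
  - rewrite <- Rmult_minus_distr_l, Rabs_mult, (Rabs_right (/ 2)) by lra.
    pose proof (lip01_le L f (2 * x) (2 * x') Hf ltac:(lra) ltac:(lra) ltac:(lra)); lra.
  - pose proof (lip01_le L f (2 * x) 1 Hf ltac:(lra) ltac:(lra) ltac:(lra)) as H1.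
    pose proof (lip01_le L g 0 (2 * x' - 1) Hg ltac:(lra) ltac:(lra) ltac:(lra)) as H2.
    replace (/ 2 * f (2 * x) - / 2 * g (2 * x' - 1))
      with (/ 2 * (f (2 * x) - f 1) + / 2 * (g 0 - g (2 * x' - 1))) by lra.
    eapply Rle_trans; [apply Rabs_triang|].
    rewrite !Rabs_mult, !(Rabs_right (/ 2)) by lra; lra.
  - rewrite <- Rmult_minus_distr_l, Rabs_mult, (Rabs_right (/ 2)) by lra.
    pose proof (lip01_le L g (2 * x - 1) (2 * x' - 1) Hg ltac:(lra) ltac:(lra) ltac:(lra)); lra.
Qed.

Lemma Rabs_affine_le B D L z : Rabs B + Rabs D / 2 <= L -> - (1 / 2) <= z <= 1 / 2 ->
  Rabs (B + D * z) <= L.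
Proof.
  intros H Hz; eapply Rle_trans; [apply Rabs_triang|].
  rewrite Rabs_mult.
  assert (Rabs z <= 1 / 2) by (apply Rabs_le; lra).
  pose proof (Rabs_pos D); nra.
Qed.

Lemma bump_field_lip_x T L : forall p y, 0 <= y <= 1 -> steep_le T L p ->
  lip01 L (fun x => bump_field T p x y).
Proof.
  induction T as [f|w a IHa b IHb c IHc d IHd]; intros p y Hy Hs; simpl in Hs.
  - intros x x' Hx Hx'; simpl; unfold bev.
    match goal with |- Rabs ?e <= _ =>
      replace e with ((pB p + pD p * (y - 1 / 2)) * (x - x')) by ring end.
    rewrite Rabs_mult; apply Rmult_le_compat_r; [apply Rabs_pos|].
    apply Rabs_affine_le; lra.
  - destruct Hs as (Ha & Hb & Hc & Hd); simpl; destruct (Rlt_dec y (1 / 2)).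
    + apply (lip01_glue L (fun x => bump_field a (child (-1) (-1) w p) x (2 * y))
                          (fun x => bump_field b (child 1 (-1) w p) x (2 * y))).
      * apply IHa; [lra | assumption].
      * apply IHb; [lra | assumption].
      * rewrite !bump_field_boundary by lra; unfold bev; simpl; field.
    + apply (lip01_glue L (fun x => bump_field c (child (-1) 1 w p) x (2 * y - 1))
                          (fun x => bump_field d (child 1 1 w p) x (2 * y - 1))).
      * apply IHc; [lra | assumption].
      * apply IHd; [lra | assumption].
      * rewrite !bump_field_boundary by lra; unfold bev; simpl; field.
Qed.

Lemma bump_field_lip_y T L : forall p x, 0 <= x <= 1 -> steep_le T L p ->
  lip01 L (fun y => bump_field T p x y).
Proof.
  induction T as [f|w a IHa b IHb c IHc d IHd]; intros p x Hx Hs; simpl in Hs.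
  - intros y y' Hy Hy'; simpl; unfold bev.
    match goal with |- Rabs ?e <= _ =>
      replace e with ((pC p + pD p * (x - 1 / 2)) * (y - y')) by ring end.
    rewrite Rabs_mult; apply Rmult_le_compat_r; [apply Rabs_pos|].
    apply Rabs_affine_le; lra.
  - destruct Hs as (Ha & Hb & Hc & Hd); simpl; destruct (Rlt_dec x (1 / 2)).
    + apply (lip01_glue L (fun y => bump_field a (child (-1) (-1) w p) (2 * x) y)
                          (fun y => bump_field c (child (-1) 1 w p) (2 * x) y)).
      * apply IHa; [lra | assumption].
      * apply IHc; [lra | assumption].
      * rewrite !bump_field_boundary by lra; unfold bev; simpl; field.
    + apply (lip01_glue L (fun y => bump_field b (child 1 (-1) w p) (2 * x - 1) y)
                          (fun y => bump_field d (child 1 1 w p) (2 * x - 1) y)).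
      * apply IHb; [lra | assumption].
      * apply IHd; [lra | assumption].
      * rewrite !bump_field_boundary by lra; unfold bev; simpl; field.
Qed.

Definition displaced (T : dtree) (p : bilin) (t x0 y0 w h : R) : set2 :=
  fun q => exists x y, 0 <= x <= 1 /\ 0 <= y <= 1 /\ in_tree (shape T) x y /\
    q = (x0 + w * x + t * w * bump_field T p x y, y0 + h * y).

(** On a leaf the shift is bilinear, so the displaced cell lies between the images of its two
    vertical sides, at a distance affine in [y]. The condition on [t] keeps [x + t v] nondecreasing
    in [x]. Quarters are displaced within half-size cells, where the scale [w / 2] matches the
    halved field. *)
Lemma outer_le_displaced T t L : Rabs t * L <= 1 -> forall p x0 y0 w h,
  0 < w -> 0 < h -> steep_le T L p ->
  outer_le (displaced T p t x0 y0 w h) (w * h * (mean (shape T) + t * dgain T p)).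
Proof.
  intros HtL; induction T as [f|k a IHa b IHb c IHc d IHd]; intros p x0 y0 w h Hw Hh Hs;
    simpl in Hs.
  - destruct f; simpl.
    2: { eapply outer_le_mono; [| |apply outer_le_empty]; [|lra].
         intros q (x & y & _ & _ & Hf & _); discriminate Hf. }
    destruct Hs as [HB HC].
    set (l := fun y => x0 + t * w * bev p 0 ((y - y0) / h)).
    set (r := fun y => x0 + w + t * w * bev p 1 ((y - y0) / h)).
    assert (Hslope : forall y, 0 <= y <= 1 -> 0 <= 1 + t * (pB p + pD p * (y - 1 / 2))).
    { intros y Hy.
      assert (H1 : Rabs (pB p + pD p * (y - 1 / 2)) <= L) by (apply Rabs_affine_le; lra).
      assert (H2 : Rabs (t * (pB p + pD p * (y - 1 / 2))) <= 1).
      { rewrite Rabs_mult; pose proof (Rabs_pos t); nra. }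
      pose proof (Rle_abs (- (t * (pB p + pD p * (y - 1 / 2))))) as H3;
        rewrite Rabs_Ropp in H3; lra. }
    (* The width [w (1 + t (B + D (y - 1/2)))], rewritten in the absolute height [y0 + h y]; at
       mid-height the [D] terms cancel. *)
    apply outer_le_mono with (between l r y0 h)
      (h * ((w * (1 + t * pB p - t * pD p / 2 - t * pD p * y0 / h))
            + (w * t * pD p / h) * (y0 + h / 2))).
    + intros q (x & y & Hx & Hy & _ & ->); unfold between, l, r; simpl.
      replace ((y0 + h * y - y0) / h) with y by (field; lra).
      specialize (Hslope y Hy); split; [nra|].
      assert (H0 : 0 <= w * (x * (1 + t * (pB p + pD p * (y - 1 / 2))))).
      { apply Rmult_le_pos; [lra | apply Rmult_le_pos; lra]. }
      assert (H1 : 0 <= w * ((1 - x) * (1 + t * (pB p + pD p * (y - 1 / 2))))).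
      { apply Rmult_le_pos; [lra | apply Rmult_le_pos; lra]. }
      unfold bev; lra.
    + apply Req_le; field; lra.
    + assert (Hlip : forall z y y', 0 <= z <= 1 ->
         Rabs (t * w * bev p z ((y - y0) / h) - t * w * bev p z ((y' - y0) / h))
         <= (Rabs (t * w) * L / h) * Rabs (y - y')).
      { intros z y y' Hz.
        replace (t * w * bev p z ((y - y0) / h) - t * w * bev p z ((y' - y0) / h))
          with (t * w * (pC p + pD p * (z - 1 / 2)) * ((y - y') * / h))
          by (unfold bev; field; lra).
        rewrite !Rabs_mult, (Rabs_right (/ h)).
        2: { apply Rle_ge, Rlt_le, Rinv_0_lt_compat; lra. }
        rewrite <- (Rabs_mult t w).
        assert (H1 : Rabs (pC p + pD p * (z - 1 / 2)) <= L) by (apply Rabs_affine_le; lra).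
        replace (Rabs (t * w) * L / h * Rabs (y - y'))
          with (Rabs (t * w) * L * (Rabs (y - y') * / h)) by (field; lra).
        apply Rmult_le_compat_r.
        - apply Rmult_le_pos; [apply Rabs_pos | apply Rlt_le, Rinv_0_lt_compat; lra].
        - apply Rmult_le_compat_l; [apply Rabs_pos | exact H1]. }
      apply outer_le_between with (Rabs (t * w) * L / h); try lra.
      * intros y y' _ _; unfold l.
        match goal with |- Rabs ?e <= _ =>
          replace e with (t * w * bev p 0 ((y - y0) / h) - t * w * bev p 0 ((y' - y0) / h)) by ring end.
        apply Hlip; lra.
      * intros y y' _ _; unfold r.
        match goal with |- Rabs ?e <= _ =>
          replace e with (t * w * bev p 1 ((y - y0) / h) - t * w * bev p 1 ((y' - y0) / h)) by ring end.
        apply Hlip; lra.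
      * intros y Hy.
        assert (Hz : 0 <= (y - y0) / h <= 1).
        { split; [apply Rmult_le_pos; [lra | apply Rlt_le, Rinv_0_lt_compat; lra]|].
          apply Rmult_le_reg_r with h; [lra|].
          replace ((y - y0) / h * h) with (y - y0) by (field; lra); lra. }
        specialize (Hslope _ Hz).
        assert (E : r y = l y + w * (1 + t * (pB p + pD p * ((y - y0) / h - 1 / 2)))).
        { unfold l, r, bev; ring. }
        split.
        -- rewrite E; nra.
        -- rewrite E; apply Req_le; field; lra.
      * apply Rmult_le_pos; [|apply Rlt_le, Rinv_0_lt_compat; lra].
        apply Rmult_le_pos; [apply Rabs_pos|].
        pose proof (Rabs_pos (pC p)); pose proof (Rabs_pos (pD p)); lra.
  - destruct Hs as (Ha & Hb & Hc & Hd).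
    specialize (IHa _ x0 y0 (w / 2) (h / 2) ltac:(lra) ltac:(lra) Ha).
    specialize (IHb _ (x0 + w / 2) y0 (w / 2) (h / 2) ltac:(lra) ltac:(lra) Hb).
    specialize (IHc _ x0 (y0 + h / 2) (w / 2) (h / 2) ltac:(lra) ltac:(lra) Hc).
    specialize (IHd _ (x0 + w / 2) (y0 + h / 2) (w / 2) (h / 2) ltac:(lra) ltac:(lra) Hd).
    eapply outer_le_mono;
      [| |exact (outer_le_union _ _ _ _ (outer_le_union _ _ _ _ IHa IHb) (outer_le_union _ _ _ _ IHc IHd))].
    + intros q (x & y & Hx & Hy & Hin & ->); simpl in Hin |- *.
      destruct (Rlt_dec x (1 / 2)); destruct (Rlt_dec y (1 / 2)).
      * left; left; exists (2 * x), (2 * y); repeat split; try lra; auto; f_equal; lra.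
      * right; left; exists (2 * x), (2 * y - 1); repeat split; try lra; auto; f_equal; lra.
      * left; right; exists (2 * x - 1), (2 * y); repeat split; try lra; auto; f_equal; lra.
      * right; right; exists (2 * x - 1), (2 * y - 1); repeat split; try lra; auto; f_equal; lra.
    + simpl; apply Req_le; field.
Qed.

Lemma in_tree_bottom_top T : forall x y,
  in_tree T x y -> (y < 1 / 2 -> in_tree (bottom T) x (2 * y)) /\ (1 / 2 <= y -> in_tree (top T) x (2 * y - 1)).
Proof.
  induction T as [f|a IHa b IHb c IHc d IHd]; intros x y H; [simpl in *; tauto|].
  cbn [bottom top]; cbn [in_tree] in H |- *.
  destruct (Rlt_dec x (1 / 2)); destruct (Rlt_dec y (1 / 2)); split; intros Hy; try lra.
  - apply IHa in H; destruct (Rlt_dec (2 * y) (1 / 2)); apply H; lra.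
  - apply IHc in H; destruct (Rlt_dec (2 * y - 1) (1 / 2)); apply H; lra.
  - apply IHb in H; destruct (Rlt_dec (2 * y) (1 / 2)); apply H; lra.
  - apply IHd in H; destruct (Rlt_dec (2 * y - 1) (1 / 2)); apply H; lra.
Qed.

Lemma in_tree_transpose T : forall x y, in_tree (transpose T) x y <-> in_tree T y x.
Proof.
  induction T as [f|a IHa b IHb c IHc d IHd]; intros x y; simpl; [tauto|].
  destruct (Rlt_dec x (1 / 2)); destruct (Rlt_dec y (1 / 2)); auto.
Qed.

(** * Extension of the field to the plane *)

Definition clamp (x : R) : R := Rmax 0 (Rmin 1 x).

Lemma clamp_bounds x : 0 <= clamp x <= 1.
Proof. unfold clamp; minmax. Qed.

Lemma clamp_id x : 0 <= x <= 1 -> clamp x = x.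
Proof. intros; unfold clamp; minmax. Qed.

Lemma clamp_lip x x' : Rabs (clamp x - clamp x') <= Rabs (x - x').
Proof. unfold clamp, Rmax, Rmin; repeat destruct (Rle_dec _ _); cases_abs. Qed.

Definition half_field (T : qtree) : R -> R -> R := bump_field (bumps T) pzero.

Definition field01 (T : qtree) (x y : R) : R :=
  if Rlt_dec y (1 / 2) then half_field (bottom T) x (2 * y) else half_field (top T) x (2 * y - 1).

Definition vfield (T : qtree) (x y : R) : R := field01 T (clamp x) (clamp y).

Lemma half_field_boundary T x y : 0 <= x <= 1 -> 0 <= y <= 1 ->
  x = 0 \/ x = 1 \/ y = 0 \/ y = 1 -> half_field T x y = 0.
Proof.
  intros; unfold half_field; rewrite bump_field_boundary by assumption; unfold bev; simpl; ring.
Qed.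

Definition open_square (p : pt) : Prop := 0 < fst p < 1 /\ 0 < snd p < 1.

Lemma vfield_outside T x y : ~ open_square (x, y) -> vfield T x y = 0.
Proof.
  intros H; unfold vfield, field01.
  assert (Hb : clamp x = 0 \/ clamp x = 1 \/ clamp y = 0 \/ clamp y = 1).
  { apply NNPP; intros Hn; apply H; split; simpl; unfold clamp in Hn; minmax. }
  pose proof (clamp_bounds x); pose proof (clamp_bounds y).
  destruct (Rlt_dec _ _); apply half_field_boundary; lra.
Qed.

Lemma vfield_lip_x T x x' y : Rabs (vfield T x y - vfield T x' y) <= 4 * Rabs (x - x').
Proof.
  unfold vfield, field01.
  pose proof (clamp_bounds x); pose proof (clamp_bounds x'); pose proof (clamp_bounds y).
  apply Rle_trans with (4 * Rabs (clamp x - clamp x')).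
  2: { pose proof (clamp_lip x x'); lra. }
  destruct (Rlt_dec _ _); unfold half_field.
  - apply (bump_field_lip_x _ 4 pzero (2 * clamp y)); auto; [lra | apply steep_bumps].
  - apply (bump_field_lip_x _ 4 pzero (2 * clamp y - 1)); auto; [lra | apply steep_bumps].
Qed.

Lemma vfield_lip_y T x y y' : Rabs (vfield T x y - vfield T x y') <= 8 * Rabs (y - y').
Proof.
  unfold vfield.
  pose proof (clamp_bounds x); pose proof (clamp_bounds y); pose proof (clamp_bounds y').
  apply Rle_trans with (8 * Rabs (clamp y - clamp y')).
  2: { pose proof (clamp_lip y y'); lra. }
  (* The two halves are compressed vertically without halving the values. The factor 2 cancels the
     [/ 2] of [lip01_glue] and doubles the slope 4. *)
  assert (Hd : forall T, lip01 8 (fun z => 2 * half_field T (clamp x) z)).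
  { intros T' z z' Hz Hz'; rewrite <- Rmult_minus_distr_l, Rabs_mult, (Rabs_right 2) by lra.
    pose proof (bump_field_lip_y _ 4 pzero (clamp x) ltac:(lra) (steep_bumps T') z z' Hz Hz') as H2.
    unfold half_field; lra. }
  pose proof (lip01_glue 8 _ _ (Hd (bottom T)) (Hd (top T))) as Hg.
  assert (Hg' := Hg ltac:(cbv beta; rewrite !half_field_boundary by lra; reflexivity) (clamp y) (clamp y') ltac:(lra) ltac:(lra)).
  cbv beta in Hg'; unfold field01.
  eapply Rle_trans; [|exact Hg'].
  apply Req_le; f_equal; destruct (Rlt_dec (clamp y) _); destruct (Rlt_dec (clamp y') _); lra.
Qed.

(** * Shear homeomorphisms *)

Definition dist1 (p q : pt) : R := Rabs (fst p - fst q) + Rabs (snd p - snd q).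

(** The maps act on the whole plane with an explicit inverse, and the distance is the sum norm,
    which suits shears along the axes; the comparison with the Euclidean norm is made only at the
    end. *)
Record bilip (L : R) (phi psi : pt -> pt) : Prop := {
  bilip_lr : forall p, psi (phi p) = p;
  bilip_rl : forall p, phi (psi p) = p;
  bilip_lip : forall p q, dist1 (phi p) (phi q) <= L * dist1 p q;
  bilip_lip_inv : forall p q, dist1 (psi p) (psi q) <= L * dist1 p q;
  bilip_id : forall p, ~ open_square p -> phi p = p
}.

Section Shear.

Variable u : R -> R -> R.
Hypothesis u_x : forall x x' y, Rabs (u x y - u x' y) <= / 4 * Rabs (x - x').
Hypothesis u_y : forall x y y', Rabs (u x y - u x y') <= / 2 * Rabs (y - y').
Hypothesis u_out : forall x y, ~ open_square (x, y) -> u x y = 0.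

Definition shear (p : pt) : pt := (fst p - u (fst p) (snd p), snd p).

Lemma u_lip x y x' y' : Rabs (u x y - u x' y') <= / 4 * Rabs (x - x') + / 2 * Rabs (y - y').
Proof.
  replace (u x y - u x' y') with ((u x y - u x' y) + (u x' y - u x' y')) by ring.
  eapply Rle_trans; [apply Rabs_triang|].
  specialize (u_x x x' y); specialize (u_y x' y y'); lra.
Qed.

Lemma shear_onto X y : exists x, x - u x y = X.
Proof.
  set (f := fun x => x - u x y - X).
  assert (Hf : forall x x', Rabs (f x - f x') <= 2 * Rabs (x - x')).
  { intros x x'; unfold f; specialize (u_x x x' y).
    replace (x - u x y - X - (x' - u x' y - X)) with ((x - x') - (u x y - u x' y)) by ring.
    eapply Rle_trans; [apply Rabs_triang|]; rewrite Rabs_Ropp.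
    pose proof (Rabs_pos (x - x')); lra. }
  assert (Hc : continuity f).
  { intros x e He; exists (e / 2); split; [lra|].
    intros x' [_ Hx']; simpl in *; unfold Rdist in *.
    specialize (Hf x' x); lra. }
  (* Within distance [2 c] of [X], the function [u] changes by at most [c / 2], so its modulus stays
     below [2 c] up to equality and [f] changes sign. *)
  set (c := Rabs (u X y)).
  assert (H1 : f (X - 2 * c) <= 0).
  { unfold f; pose proof (u_x (X - 2 * c) X y) as H; pose proof (Rabs_pos (u X y)) as Hc0; fold c in Hc0.
    replace (X - 2 * c - X) with (- (2 * c)) in H by ring.
    rewrite Rabs_Ropp, (Rabs_right (2 * c)) in H by lra.
    pose proof (Rle_abs (- (u X y))) as H2; rewrite Rabs_Ropp in H2; fold c in H2.
    pose proof (Rle_abs (- (u (X - 2 * c) y - u X y))) as H3; rewrite Rabs_Ropp in H3; lra. }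
  assert (H2 : 0 <= f (X + 2 * c)).
  { unfold f; pose proof (u_x (X + 2 * c) X y) as H; pose proof (Rabs_pos (u X y)) as Hc0; fold c in Hc0.
    replace (X + 2 * c - X) with (2 * c) in H by ring.
    rewrite (Rabs_right (2 * c)) in H by lra.
    pose proof (Rle_abs (u X y)) as H2; fold c in H2.
    pose proof (Rle_abs (u (X + 2 * c) y - u X y)) as H3; lra. }
  destruct (IVT_cor f (X - 2 * c) (X + 2 * c)) as [z [_ Hz]]; auto.
  - pose proof (Rabs_pos (u X y)) as Hc0; fold c in Hc0; lra.
  - nra.
  - exists z; unfold f in Hz; lra.
Qed.

Definition unshear (q : pt) : pt :=
  (proj1_sig (constructive_indefinite_description _ (shear_onto (fst q) (snd q))), snd q).

Lemma shearK q : shear (unshear q) = q.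
Proof.
  destruct q as [X y]; unfold shear, unshear; simpl.
  destruct (constructive_indefinite_description _ _) as [x Hx]; simpl in *; congruence.
Qed.

(** The term [1/4 |x - x'|] from the variation of [u] is absorbed on the left. This yields both
    injectivity and the Lipschitz bound of the inverse. *)
Lemma shear_expand p q : dist1 p q <= 2 * dist1 (shear p) (shear q).
Proof.
  destruct p as [x y], q as [x' y']; unfold dist1, shear; simpl.
  pose proof (u_lip x y x' y') as H.
  assert (H1 : Rabs (x - x') <= Rabs (x - u x y - (x' - u x' y')) + Rabs (u x y - u x' y')).
  { replace (x - x') with ((x - u x y - (x' - u x' y')) + (u x y - u x' y')) at 1 by ring.
    apply Rabs_triang. }
  pose proof (Rabs_pos (y - y')).
  pose proof (Rabs_pos (x - u x y - (x' - u x' y'))); lra.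
Qed.

Lemma dist1_eq0 p q : dist1 p q <= 0 -> p = q.
Proof.
  destruct p as [x y], q as [x' y']; unfold dist1; simpl; intros H.
  pose proof (Rabs_pos (x - x')); pose proof (Rabs_pos (y - y')).
  f_equal; apply Rminus_diag_uniq; destruct (Req_dec (x - x') 0), (Req_dec (y - y') 0);
    try assumption; try (pose proof (Rabs_pos_lt (x - x') ltac:(assumption)); lra);
    pose proof (Rabs_pos_lt (y - y') ltac:(assumption)); lra.
Qed.

Lemma dist1_refl p : dist1 p p = 0.
Proof. unfold dist1; rewrite !Rminus_diag, Rabs_R0; ring. Qed.

Lemma bilip_shear : bilip 2 shear unshear.
Proof.
  split.
  - intros p; apply dist1_eq0; pose proof (shear_expand (unshear (shear p)) p) as H.
    rewrite shearK, dist1_refl in H; lra.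
  - exact shearK.
  - intros [x y] [x' y']; unfold dist1, shear; simpl; pose proof (u_lip x y x' y').
    assert (H1 : Rabs (x - u x y - (x' - u x' y')) <= Rabs (x - x') + Rabs (u x y - u x' y')).
    { replace (x - u x y - (x' - u x' y')) with ((x - x') + - (u x y - u x' y')) by ring.
      eapply Rle_trans; [apply Rabs_triang|]; rewrite Rabs_Ropp; lra. }
    pose proof (Rabs_pos (y - y')); pose proof (Rabs_pos (x - x')); lra.
  - intros p q; pose proof (shear_expand (unshear p) (unshear q)) as H.
    rewrite !shearK in H; exact H.
  - intros [x y] H; unfold shear; simpl; rewrite (u_out x y H); f_equal; ring.
Qed.

Lemma outer_le_shear_rect r : rect_ok r ->
  outer_le (image2 shear (in_rect r)) (2 * rect_area r).
Proof.
  destruct r as [[[a b] c] d]; intros [Hab Hcd].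
  assert (Hm : forall x x' y, x <= x' -> x - u x y <= x' - u x' y <= x - u x y + 2 * (x' - x)).
  { intros x x' y Hx; pose proof (u_x x x' y) as H.
    rewrite (Rabs_minus_sym x x'), (Rabs_right (x' - x)) in H by lra.
    pose proof (Rle_abs (u x y - u x' y)).
    pose proof (Rle_abs (- (u x y - u x' y))) as H1; rewrite Rabs_Ropp in H1; lra. }
  apply outer_le_mono with (between (fun y => a - u a y) (fun y => b - u b y) c (d - c))
     ((d - c) * (2 * (b - a) + 0 * (c + (d - c) / 2))).
  - intros q (p & Hp & <-); destruct p as [x y]; simpl in Hp; unfold between, shear; simpl.
    pose proof (Hm a x y ltac:(lra)); pose proof (Hm x b y ltac:(lra)); lra.
  - simpl; lra.
  - apply outer_le_between with (/ 2); try lra.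
    + intros y y' _ _; specialize (u_y a y' y).
      replace (a - u a y - (a - u a y')) with (u a y' - u a y) by ring.
      rewrite (Rabs_minus_sym y y'); exact u_y.
    + intros y y' _ _; specialize (u_y b y' y).
      replace (b - u b y - (b - u b y')) with (u b y' - u b y) by ring.
      rewrite (Rabs_minus_sym y y'); exact u_y.
    + intros y _; pose proof (Hm a b y Hab); lra.
Qed.

Lemma outer_le_shear (E : set2) s : outer_le E s -> outer_le (image2 shear E) (2 * s).
Proof.
  intros H; apply outer_le_closed; intros e He.
  destruct (H (e / 2) ltac:(lra)) as (rs & H1 & H2 & H3).
  apply outer_le_mono with (fun q => exists n, image2 shear (in_rect (rs n)) q) (2 * s + e).
  - intros q (p & Hp & <-); destruct (H2 p Hp) as [n Hn]; exists n, p; tauto.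
  - lra.
  - apply outer_le_countable with (fun n => 2 * rect_area (rs n)).
    + intros n; apply outer_le_shear_rect, H1.
    + intros n; rewrite (sum_eq _ (fun k => rect_area (rs k) * 2)) by (intros; ring).
      rewrite <- scal_sum; specialize (H3 n); lra.
Qed.

End Shear.

(** * Contraction of quadtree regions *)

Definition region (T : qtree) : set2 := fun p => square p /\ in_tree T (fst p) (snd p).

(** The second clause controls the image of the small error set between a Borel set and the quadtree
    that approximates it. *)
Definition contracts (phi : pt -> pt) (T : qtree) (m : R) : Prop :=
  outer_le (image2 phi (region T)) m /\
  forall E s, outer_le E s -> outer_le (image2 phi E) (2 * s).

Lemma shear_contracts T : exists phi psi, bilip 2 phi psi /\
  contracts phi T (mean T - xgain T / 32).
Proof.
  (* Division by 16 turns the slopes 4 and 8 of the field into the 1/4 and 1/2 required of a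
     shear. *)
  set (u := fun x y => vfield T x y / 16).
  assert (Hx : forall x x' y, Rabs (u x y - u x' y) <= / 4 * Rabs (x - x')).
  { intros x x' y; pose proof (vfield_lip_x T x x' y); unfold u.
    replace (vfield T x y / 16 - vfield T x' y / 16)
      with (/ 16 * (vfield T x y - vfield T x' y)) by field.
    rewrite Rabs_mult, (Rabs_right (/ 16)) by lra; lra. }
  assert (Hy : forall x y y', Rabs (u x y - u x y') <= / 2 * Rabs (y - y')).
  { intros x y y'; pose proof (vfield_lip_y T x y y'); unfold u.
    replace (vfield T x y / 16 - vfield T x y' / 16)
      with (/ 16 * (vfield T x y - vfield T x y')) by field.
    rewrite Rabs_mult, (Rabs_right (/ 16)) by lra; lra. }
  exists (shear u), (unshear u Hx); split.
  { apply bilip_shear; auto.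
    intros x y H; unfold u; rewrite vfield_outside by assumption; field. }
  split; [|apply outer_le_shear; auto].
  assert (Ht : Rabs (- (1 / 16)) * 4 <= 1) by (rewrite Rabs_Ropp, Rabs_right; lra).
  pose proof (outer_le_displaced (bumps (bottom T)) _ 4 Ht pzero 0 0 1 (1 / 2)
    ltac:(lra) ltac:(lra) (steep_bumps _)) as H1.
  pose proof (outer_le_displaced (bumps (top T)) _ 4 Ht pzero 0 (1 / 2) 1 (1 / 2)
    ltac:(lra) ltac:(lra) (steep_bumps _)) as H2.
  eapply outer_le_mono; [| |exact (outer_le_union _ _ _ _ H1 H2)].
  - intros q ([x y] & [Hsq Hin] & <-); unfold square in Hsq; simpl in *.
    apply in_tree_bottom_top in Hin; destruct Hin as [Hl Hu].
    unfold shear, u, vfield, field01; simpl; rewrite !clamp_id by lra.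
    destruct (Rlt_dec y (1 / 2)) as [Hlt|Hlt]; [left; exists x, (2 * y) | right; exists x, (2 * y - 1)];
      unfold bumps; rewrite shape_stopped; repeat split; try lra.
    + apply Hl, Hlt.
    + unfold half_field, bumps; f_equal; lra.
    + apply Hu; lra.
    + unfold half_field, bumps; f_equal; lra.
  (* Each half has area 1/2 and gains at least half of its bump energy, so the decrease is at least
     1/16 times 1/2 times 1/2 times the sum [2 * xgain T] of the two energies. *)
  - pose proof (dgain_bumps (bottom T)); pose proof (dgain_bumps (top T)).
    pose proof (mean_bottom_top T); unfold bumps in *; rewrite !shape_stopped.
    unfold xgain; lra.
Qed.

Lemma dist1_swap p q : dist1 (swap p) (swap q) = dist1 p q.
Proof. unfold dist1, swap; simpl; ring. Qed.

Lemma bilip_swap L phi psi : bilip L phi psi ->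
  bilip L (fun p => swap (phi (swap p))) (fun p => swap (psi (swap p))).
Proof.
  intros [H1 H2 H3 H4 H5]; split; intros p.
  - rewrite swapK, H1, swapK; reflexivity.
  - rewrite swapK, H2, swapK; reflexivity.
  - intros q; rewrite dist1_swap, <- (dist1_swap p q); apply H3.
  - intros q; rewrite dist1_swap, <- (dist1_swap p q); apply H4.
  - intros Hp; rewrite H5; [apply swapK|].
    unfold open_square, swap in *; simpl; tauto.
Qed.

Lemma outer_le_image_swap phi (E E' : set2) s :
  (forall p, E p -> E' (swap p)) ->
  outer_le (image2 phi E') s -> outer_le (image2 (fun p => swap (phi (swap p))) E) s.
Proof.
  intros HE H.
  eapply outer_le_mono; [|apply Rle_refl|apply (outer_le_swap _ _ H)].
  intros q (p & Hp & <-); exists (swap p); rewrite swapK; auto.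
Qed.

(** The constant is [2304 = 72 * 32]. If the gain is large only for the transpose, the shear is
    conjugated with the exchange of coordinates. *)
Lemma tree_step T : exists phi psi, bilip 2 phi psi /\
  contracts phi T (mean T - (mean T - mean T ^ 2) / 2304).
Proof.
  destruct (xgain_or_transpose T) as [H|H].
  - destruct (shear_contracts T) as (phi & psi & Hg & Hc & HE).
    exists phi, psi; split; [exact Hg | split; [|exact HE]].
    eapply outer_le_mono; [intros x Hx; exact Hx | | exact Hc]; lra.
  - destruct (shear_contracts (transpose T)) as (phi & psi & Hg & Hc & HE).
    exists (fun p => swap (phi (swap p))), (fun p => swap (psi (swap p))).
    split; [apply bilip_swap, Hg | split].
    + apply outer_le_image_swap with (region (transpose T)).
      * intros p [H1 H2]; split; [unfold square, swap in *; simpl; tauto|].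
        apply in_tree_transpose; exact H2.
      * eapply outer_le_mono; [intros x Hx; exact Hx | | exact Hc].
        rewrite mean_transpose; lra.
    + intros E s Hs; apply outer_le_image_swap with (fun p => E (swap p)).
      * intros p Hp; rewrite swapK; exact Hp.
      * apply HE, outer_le_swap, Hs.
Qed.

(** * Borel sets are approximated by quadtrees *)

Fixpoint tmap (f : bool -> bool) (T : qtree) : qtree :=
  match T with
  | Leaf b => Leaf (f b)
  | Node a b c d => Node (tmap f a) (tmap f b) (tmap f c) (tmap f d)
  end.

Fixpoint tmap2 (f : bool -> bool -> bool) (S T : qtree) : qtree :=
  match S, T with
  | Leaf s, _ => tmap (f s) T
  | Node a b c d, Leaf t =>
      Node (tmap2 f a T) (tmap2 f b T) (tmap2 f c T) (tmap2 f d T)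
  | Node a b c d, Node a' b' c' d' =>
      Node (tmap2 f a a') (tmap2 f b b') (tmap2 f c c') (tmap2 f d d')
  end.

(** A common label [t] at each point describes both trees, so that every Boolean operation reduces
    to a case check on labels. *)
Lemma in_tree_tmap f T : forall x y, exists t,
  (in_tree T x y <-> t = true) /\ (in_tree (tmap f T) x y <-> f t = true).
Proof.
  induction T as [b|a IHa b IHb c IHc d IHd]; intros x y; simpl.
  - exists b; tauto.
  - destruct (Rlt_dec x (1 / 2)); destruct (Rlt_dec y (1 / 2)); auto.
Qed.

Lemma in_tree_tmap2 f S : forall T x y, exists s t,
  (in_tree S x y <-> s = true) /\ (in_tree T x y <-> t = true) /\
  (in_tree (tmap2 f S T) x y <-> f s t = true).
Proof.
  induction S as [s|a IHa b IHb c IHc d IHd]; intros T x y.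
  - destruct (in_tree_tmap (f s) T x y) as (t & H1 & H2).
    exists s, t; simpl; tauto.
  - destruct T as [t|a' b' c' d']; simpl.
    + destruct (Rlt_dec x (1 / 2)); destruct (Rlt_dec y (1 / 2));
        [apply (IHa (Leaf t)) | apply (IHc (Leaf t)) | apply (IHb (Leaf t)) | apply (IHd (Leaf t))].
    + destruct (Rlt_dec x (1 / 2)); destruct (Rlt_dec y (1 / 2)); auto.
Qed.

Definition tnot := tmap negb.
Definition tor := tmap2 orb.
Definition tminus := tmap2 (fun s t => andb s (negb t)).

Lemma in_tree_tnot T x y : in_tree (tnot T) x y <-> ~ in_tree T x y.
Proof.
  destruct (in_tree_tmap negb T x y) as (t & H1 & H2); unfold tnot; rewrite H1, H2.
  destruct t; simpl; intuition congruence.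
Qed.

Lemma in_tree_tor S T x y : in_tree (tor S T) x y <-> in_tree S x y \/ in_tree T x y.
Proof.
  destruct (in_tree_tmap2 orb S T x y) as (s & t & H1 & H2 & H3); unfold tor; rewrite H1, H2, H3.
  destruct s, t; simpl; intuition congruence.
Qed.

Lemma in_tree_tminus S T x y : in_tree (tminus S T) x y <-> in_tree S x y /\ ~ in_tree T x y.
Proof.
  destruct (in_tree_tmap2 (fun s t => andb s (negb t)) S T x y) as (s & t & H1 & H2 & H3).
  unfold tminus; rewrite H1, H2, H3; destruct s, t; simpl; intuition congruence.
Qed.

Lemma mean_tnot T : mean (tnot T) = 1 - mean T.
Proof.
  unfold tnot; induction T as [b|]; simpl; [destruct b; simpl|]; lra.
Qed.

Lemma mean_tor S : forall T, mean (tor S T) = mean S + mean (tminus T S).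
Proof.
  unfold tor, tminus; induction S as [s|a IHa b IHb c IHc d IHd]; intros T.
  - induction T as [t|]; simpl in *; [destruct s, t; simpl | ]; lra.
  - destruct T as [t|a' b' c' d']; simpl.
    + specialize (IHa (Leaf t)); specialize (IHb (Leaf t)).
      specialize (IHc (Leaf t)); specialize (IHd (Leaf t)); simpl in *; lra.
    + rewrite IHa, IHb, IHc, IHd; lra.
Qed.

Lemma steep_frozen_zero T : steep_le (frozen T) 0 pzero.
Proof. apply steep_frozen; simpl; rewrite Rabs_R0; lra. Qed.

Lemma outer_le_region T : outer_le (region T) (mean T).
Proof.
  eapply outer_le_mono;
    [| |exact (outer_le_displaced (frozen T) 0 0 ltac:(rewrite Rabs_R0; lra) pzero 0 0 1 1
              ltac:(lra) ltac:(lra) (steep_frozen_zero T))].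
  - intros [x y] [Hsq Hin]; unfold square in Hsq; simpl in *.
    exists x, y; rewrite shape_frozen; repeat split; try lra; auto.
    f_equal; ring.
  - rewrite shape_frozen; lra.
Qed.

(** The lower bound comes from the unit square: the region and its complement, of outer measure at
    most [1 - mean T], together cover it. *)
Lemma mean_le_outer T s : outer_le (region T) s -> mean T <= s.
Proof.
  intros H.
  pose proof (outer_le_union _ _ _ _ H (outer_le_region (tnot T))) as Hu.
  rewrite mean_tnot in Hu.
  enough (1 <= s + (1 - mean T)) by lra.
  apply outer_le_square_ge1.
  eapply outer_le_mono; [|apply Rle_refl|exact Hu].
  intros p Hp; destruct (classic (in_tree T (fst p) (snd p))) as [Hin|Hin]; [left | right]; split; auto.
  apply in_tree_tnot, Hin.
Qed.

(** Both parts of the symmetric difference with a dyadic set are small. The property holds for open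
    sets and passes to complements and countable unions, hence it holds for Borel sets. *)
Definition approx (A : set2) : Prop :=
  forall e, 0 < e -> exists T,
    outer_le (fun p => square p /\ A p /\ ~ in_tree T (fst p) (snd p)) e /\
    outer_le (fun p => square p /\ in_tree T (fst p) (snd p) /\ ~ A p) e.

Lemma approx_ext (A B : set2) : (forall p, square p -> (A p <-> B p)) -> approx A -> approx B.
Proof.
  intros HAB HA e He; destruct (HA e He) as (T & H1 & H2).
  exists T; split; eapply outer_le_mono; [|apply Rle_refl|exact H1| |apply Rle_refl|exact H2];
    simpl; intros p (Hp & Hx); specialize (HAB p Hp); tauto.
Qed.

Lemma approx_tree T : approx (fun p => in_tree T (fst p) (snd p)).
Proof.
  intros e He; exists T; split;
    (eapply outer_le_mono; [| |exact outer_le_empty]; [simpl; tauto | lra]).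
Qed.

Lemma approx_compl A : approx A -> approx (fun p => ~ A p).
Proof.
  intros HA e He; destruct (HA e He) as (T & H1 & H2).
  exists (tnot T); split.
  - eapply outer_le_mono; [|apply Rle_refl|exact H2].
    simpl; intros p (Hp & HnA & Hn); rewrite in_tree_tnot in Hn; apply NNPP in Hn; tauto.
  - eapply outer_le_mono; [|apply Rle_refl|exact H1].
    simpl; intros p (Hp & Hn & HnA); rewrite in_tree_tnot in Hn; apply NNPP in HnA; tauto.
Qed.

Fixpoint tunion (T : nat -> qtree) (n : nat) : qtree :=
  match n with O => T O | S n => tor (tunion T n) (T (S n)) end.

Lemma in_tree_tunion T n x y : in_tree (tunion T n) x y <-> exists k, (k <= n)%nat /\ in_tree (T k) x y.
Proof.
  induction n; simpl.
  - split; [intros H; exists 0%nat; auto | intros (k & Hk & H)].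
    replace 0%nat with k by lia; exact H.
  - rewrite in_tree_tor, IHn; split.
    + intros [(k & Hk & H)|H]; [exists k | exists (S n)]; split; auto.
    + intros (k & Hk & H); destruct (Nat.eq_dec k (S n)) as [->|Hne]; [right; exact H|].
      left; exists k; split; [lia | exact H].
Qed.

Lemma mean_tunion_stable T e : 0 < e ->
  exists M, forall n, mean (tunion T (n + M)) <= mean (tunion T M) + e.
Proof.
  intros He.
  destruct (completeness (fun z => exists n, z = mean (tunion T n))) as [X [HX1 HX2]].
  - exists 1; intros z [n ->]; apply mean_bounds.
  - exists (mean (tunion T 0)), 0%nat; reflexivity.
  - apply NNPP; intros Hno.
    assert (X <= X - e); [|lra].
    apply HX2; intros z [M ->].
    apply Rnot_lt_le; intros Hlt; apply Hno; exists M; intros n.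
    assert (mean (tunion T (n + M)) <= X) by (apply HX1; exists (n + M)%nat; reflexivity).
    lra.
Qed.

Lemma tunion_first T M x y n : ~ in_tree (tunion T M) x y -> in_tree (tunion T (n + M)) x y ->
  exists k, in_tree (tminus (T (S (k + M))) (tunion T (k + M))) x y.
Proof.
  intros H0; induction n; simpl; intros H; [contradiction|].
  destruct (classic (in_tree (tunion T (n + M)) x y)) as [Hn|Hn]; [apply IHn, Hn|].
  exists n; rewrite in_tree_tminus; split; [|exact Hn].
  rewrite in_tree_tor in H; tauto.
Qed.

(** One half of [e] pays for the errors of the trees [T n], the other for replacing their infinite
    union by a finite one, whose measure can grow by at most [e / 2] afterwards. *)
Lemma approx_union (F : nat -> set2) :
  (forall n, approx (F n)) -> approx (fun p => exists n, F n p).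
Proof.
  intros HF e He.
  assert (He' : forall n, 0 < e / 2 * (/ 2) ^ (S n)).
  { intros n; apply Rmult_lt_0_compat; [lra | apply pow_lt; lra]. }
  set (T := fun n => proj1_sig (constructive_indefinite_description _ (HF n _ (He' n)))).
  assert (HT : forall n,
    outer_le (fun p => square p /\ F n p /\ ~ in_tree (T n) (fst p) (snd p)) (e / 2 * (/ 2) ^ (S n)) /\
    outer_le (fun p => square p /\ in_tree (T n) (fst p) (snd p) /\ ~ F n p) (e / 2 * (/ 2) ^ (S n))).
  { intros n; unfold T.
    exact (proj2_sig (constructive_indefinite_description _ (HF n _ (He' n)))). }
  clearbody T.
  assert (Hgeo : forall n, sum_f_R0 (fun k => e / 2 * (/ 2) ^ (S k)) n <= e / 2).
  { intros n; rewrite (sum_eq _ (fun k => (/ 2) ^ (S k) * (e / 2))) by (intros; ring).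
    rewrite <- scal_sum; pose proof (sum_half_pow n); nra. }
  destruct (mean_tunion_stable T (e / 2) ltac:(lra)) as [M HM].
  exists (tunion T M); split.
  - pose proof (outer_le_countable _ _ _ (fun n => proj1 (HT n)) Hgeo) as H1.
    assert (H2 : outer_le (fun p => exists n,
      region (tminus (T (S (n + M))) (tunion T (n + M))) p) (e / 2)).
    { apply outer_le_countable with (fun n => mean (tminus (T (S (n + M))) (tunion T (n + M)))).
      - intros n; apply outer_le_region.
      - intros n.
        (* The sets of points entering the union at successive indices have means that telescope. *)
        assert (E : sum_f_R0 (fun n => mean (tminus (T (S (n + M))) (tunion T (n + M)))) n
          = mean (tunion T (S n + M)) - mean (tunion T M)).
        { induction n; simpl in *.
          - rewrite mean_tor; ring.
          - rewrite IHn, (mean_tor (tor _ _)); ring. }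
        rewrite E; specialize (HM (S n)); lra. }
    eapply outer_le_mono; [| |exact (outer_le_union _ _ _ _ H1 H2)]; [|lra].
    intros p (Hp & (n & Hn) & Hno).
    destruct (classic (in_tree (T n) (fst p) (snd p))) as [Hin|Hin]; [right | left; exists n; tauto].
    destruct (tunion_first T M (fst p) (snd p) n Hno) as [k Hk].
    { apply in_tree_tunion; exists n; split; [lia | exact Hin]. }
    exists k; split; assumption.
  - eapply outer_le_mono; [| |exact (outer_le_countable _ _ _ (fun n => proj2 (HT n)) Hgeo)]; [|lra].
    intros p (Hp & Hin & Hno); apply in_tree_tunion in Hin; destruct Hin as (k & _ & Hk).
    exists k; split; [exact Hp | split; [exact Hk|]].
    intros HFk; apply Hno; exists k; exact HFk.
Qed.

(** The tree marks the dyadic cells of side [2^-n] contained in [O]; the cell of a point lies within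
    [2^-n] of it in each coordinate. *)
Lemma inner_tree n : forall O : R -> R -> Prop, exists T,
  (forall x y, 0 <= x <= 1 -> 0 <= y <= 1 -> in_tree T x y -> O x y) /\
  (forall x y, 0 <= x <= 1 -> 0 <= y <= 1 ->
    (forall x' y', 0 <= x' <= 1 -> 0 <= y' <= 1 ->
      Rabs (x' - x) <= (/ 2) ^ n -> Rabs (y' - y) <= (/ 2) ^ n -> O x' y') -> in_tree T x y).
Proof.
  induction n as [|n IH]; intros O.
  - destruct (classic (forall x y, 0 <= x <= 1 -> 0 <= y <= 1 -> O x y)) as [H|H].
    + exists (Leaf true); split; simpl; auto.
    + exists (Leaf false); split; simpl; [discriminate|].
      intros x y Hx Hy HO; exfalso; apply H; intros x' y' Hx' Hy'; apply HO; auto;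
        apply Rabs_le; lra.
  - destruct (IH (fun x y => O (x / 2) (y / 2))) as (a & Ha1 & Ha2).
    destruct (IH (fun x y => O ((x + 1) / 2) (y / 2))) as (b & Hb1 & Hb2).
    destruct (IH (fun x y => O (x / 2) ((y + 1) / 2))) as (c & Hc1 & Hc2).
    destruct (IH (fun x y => O ((x + 1) / 2) ((y + 1) / 2))) as (d & Hd1 & Hd2).
    exists (Node a b c d); split; intros x y Hx Hy; simpl.
    + destruct (Rlt_dec x (1 / 2)); destruct (Rlt_dec y (1 / 2)); intros Hin;
        [apply Ha1 in Hin | apply Hc1 in Hin | apply Hb1 in Hin | apply Hd1 in Hin]; try lra;
        cbv beta in Hin;
        [ replace (2 * x / 2) with x in Hin by lra; replace (2 * y / 2) with y in Hin by lra
        | replace (2 * x / 2) with x in Hin by lra;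
          replace ((2 * y - 1 + 1) / 2) with y in Hin by lra
        | replace ((2 * x - 1 + 1) / 2) with x in Hin by lra;
          replace (2 * y / 2) with y in Hin by lra
        | replace ((2 * x - 1 + 1) / 2) with x in Hin by lra;
          replace ((2 * y - 1 + 1) / 2) with y in Hin by lra ]; exact Hin.
    + intros HO; set (r := (/ 2) ^ n) in *; clearbody r.
      destruct (Rlt_dec x (1 / 2)); destruct (Rlt_dec y (1 / 2));
        [apply Ha2 | apply Hc2 | apply Hb2 | apply Hd2]; try lra;
        intros x' y' Hx' Hy' H1 H2; apply HO; try lra; clear - H1 H2; cases_abs.
Qed.

Lemma dist2_le_dist1 p q : dist2 p q <= dist1 p q.
Proof.
  unfold dist2, dist1.
  set (a := fst p - fst q); set (b := snd p - snd q).
  pose proof (Rabs_pos a); pose proof (Rabs_pos b).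
  rewrite <- (sqrt_Rsqr (Rabs a + Rabs b)) by lra.
  apply sqrt_le_1_alt; unfold Rsqr.
  rewrite <- (pow2_abs a), <- (pow2_abs b); nra.
Qed.

Lemma dist1_le_dist2 p q : dist1 p q <= 2 * dist2 p q.
Proof.
  unfold dist2, dist1.
  set (a := fst p - fst q); set (b := snd p - snd q).
  assert (Ha : Rabs a <= sqrt (a ^ 2 + b ^ 2)).
  { rewrite <- sqrt_Rsqr_abs; apply sqrt_le_1_alt; unfold Rsqr; nra. }
  assert (Hb : Rabs b <= sqrt (a ^ 2 + b ^ 2)).
  { rewrite <- sqrt_Rsqr_abs; apply sqrt_le_1_alt; unfold Rsqr; nra. }
  lra.
Qed.

Lemma approx_open U : open2 U -> approx U.
Proof.
  intros HU.
  set (T := fun n => proj1_sig (constructive_indefinite_description _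
                       (inner_tree n (fun x y => U (x, y))))).
  assert (HT := fun n => proj2_sig (constructive_indefinite_description _
                       (inner_tree n (fun x y => U (x, y))))).
  fold T in HT.
  apply approx_ext with (fun p => exists n, in_tree (T n) (fst p) (snd p)).
  2: { apply approx_union; intros n; apply approx_tree. }
  intros [x y] [Hx Hy]; simpl in *; split.
  - intros [n Hn]; destruct (HT n) as [H1 _]; apply H1; auto.
  - intros Hxy; destruct (HU _ Hxy) as (eps & Heps & Hball).
    (* Two coordinate differences below [eps / 2] give a sum-norm distance below [eps]. *)
    destruct (pow_half_small (eps / 2)) as [n Hn]; [lra|].
    exists n; destruct (HT n) as [_ H2]; apply H2; auto.
    intros x' y' _ _ H3 H4; apply Hball.
    eapply Rle_lt_trans; [apply dist2_le_dist1|]; unfold dist1; simpl.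
    rewrite (Rabs_minus_sym x), (Rabs_minus_sym y); lra.
Qed.

Lemma borel_approx A : borel2 A -> approx A.
Proof.
  induction 1; [apply approx_open | apply approx_compl | apply approx_union]; assumption.
Qed.

(** Additivity enters here through measurability: a tree close to [A] has mean at least [g - e / 2],
    and its complement nearly covers that of [A]. *)
Lemma outer_le_compl_of_borel A g : borel2 A -> (forall x, A x -> square x) ->
  (forall s, outer_le A s -> g <= s) -> outer_le (fun p => square p /\ ~ A p) (1 - g).
Proof.
  intros HA Hsub Hg; apply outer_le_closed; intros e He.
  destruct (borel_approx A HA (e / 2) ltac:(lra)) as (T & H1 & H2).
  assert (Hm : g <= mean T + e / 2).
  { apply Hg; eapply outer_le_mono;
      [|apply Rle_refl|exact (outer_le_union _ _ _ _ (outer_le_region T) H1)].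
    intros p Hp; destruct (classic (in_tree T (fst p) (snd p))) as [Hin|Hin];
      [left | right]; unfold region; auto. }
  eapply outer_le_mono; [| |exact (outer_le_union _ _ _ _ (outer_le_region (tnot T)) H2)].
  - intros p [Hp HnA]; destruct (classic (in_tree T (fst p) (snd p))) as [Hin|Hin];
      [right; auto | left; split; auto; apply in_tree_tnot, Hin].
  - rewrite mean_tnot; lra.
Qed.

(** * Iteration *)

Lemma dist1_pos p q : 0 <= dist1 p q.
Proof. unfold dist1; pose proof (Rabs_pos (fst p - fst q)); pose proof (Rabs_pos (snd p - snd q)); lra. Qed.

Lemma bilip_id_inv L phi psi : bilip L phi psi -> forall p, ~ open_square p -> psi p = p.
Proof.
  intros G p Hp; rewrite <- (bilip_id _ _ _ G p Hp) at 1; apply (bilip_lr _ _ _ G).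
Qed.

Lemma bilip_sym L phi psi : bilip L phi psi -> bilip L psi phi.
Proof.
  intros G; pose proof (bilip_id_inv _ _ _ G); destruct G; split; assumption.
Qed.

(** A point sent outside the square would be fixed by the inverse, hence equal to its image. *)
Lemma bilip_square L phi psi : bilip L phi psi -> forall p, square p -> square (phi p).
Proof.
  intros G p Hp; apply NNPP; intros Hn; apply Hn.
  assert (E : phi p = p); [|rewrite E; exact Hp].
  rewrite <- (bilip_lr _ _ _ G p) at 2.
  symmetry; apply (bilip_id_inv _ _ _ G).
  intros Ho; apply Hn; unfold open_square, square in *; lra.
Qed.

Lemma bilip_comp L L' phi psi phi' psi' : 0 <= L -> 0 <= L' ->
  bilip L phi psi -> bilip L' phi' psi' ->
  bilip (L' * L) (fun p => phi' (phi p)) (fun p => psi (psi' p)).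
Proof.
  intros HL HL' [H1 H2 H3 H4 H5] [K1 K2 K3 K4 K5]; split; intros p.
  - rewrite K1; apply H1.
  - rewrite H2; apply K2.
  - intros q; eapply Rle_trans; [apply K3|]; rewrite Rmult_assoc.
    apply Rmult_le_compat_l; auto.
  - intros q; eapply Rle_trans; [apply H4|]; rewrite (Rmult_comm L' L), Rmult_assoc.
    apply Rmult_le_compat_l; auto.
  - intros Hp; rewrite H5 by assumption; apply K5, Hp.
Qed.

Lemma bilip_weaken L L' phi psi : L <= L' -> bilip L phi psi -> bilip L' phi psi.
Proof.
  intros HL [H1 H2 H3 H4 H5]; split; auto; intros p q;
    (eapply Rle_trans; [(apply H3 || apply H4)|]);
    apply Rmult_le_compat_r; auto using dist1_pos.
Qed.

Lemma bilip_identity : bilip 1 (fun p => p) (fun p => p).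
Proof. split; auto; intros; lra. Qed.

(** The image of [A] under [phi] is the preimage under the continuous map [psi], so it stays Borel
    and the next step of the iteration applies to it. *)
Lemma borel_preimage L phi psi A : 0 < L -> bilip L phi psi ->
  borel2 A -> borel2 (fun p => A (psi p)).
Proof.
  intros HL G HA; induction HA as [U HU|A HA IH|F HF IH].
  - apply borel_open; intros x Hx; destruct (HU _ Hx) as (eps & Heps & Hball).
    exists (eps / (2 * L)); split; [apply Rdiv_lt_0_compat; lra|].
    intros y Hy; apply Hball.
    eapply Rle_lt_trans; [apply dist2_le_dist1|].
    eapply Rle_lt_trans; [apply (bilip_lip_inv _ _ _ G)|].
    pose proof (dist1_le_dist2 x y) as H1.
    apply Rle_lt_trans with (2 * L * dist2 x y).
    + replace (2 * L * dist2 x y) with (L * (2 * dist2 x y)) by ring.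
      apply Rmult_le_compat_l; lra.
    + replace eps with (2 * L * (eps / (2 * L))) by (field; lra).
      apply Rmult_lt_compat_l; lra.
  - apply borel_compl, IH.
  - apply (borel_union (fun n p => F n (psi p))), IH.
Qed.

Definition sq_compl (A : set2) : set2 := fun p => square p /\ ~ A p.

Section Iteration.

Variables g g' : R.
Hypothesis hg : 0 < g < 1.
Hypothesis hg' : 0 < g' < 1.

(** In [improve] the variance is at least [g g' / 4], so a step gains [g g' / 9216]; the
    approximation costs [3 e] with [e = g g' / 100000], and more than [g g' / 20000] remains. *)
Definition delta : R := g * g' / 20000.

Lemma improve A b : borel2 A -> outer_le (sq_compl A) b -> b <= 1 - g ->
  outer_le (sq_compl A) g' \/
  exists phi psi, bilip 2 phi psi /\ outer_le (image2 phi (sq_compl A)) (b - delta).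
Proof.
  intros HA Hb Hbg.
  set (e := g * g' / 100000).
  assert (Hgg : 0 < g * g') by (apply Rmult_lt_0_compat; lra).
  assert (Hgg1 : g * g' <= g) by nra.
  assert (Hgg2 : g * g' <= g') by nra.
  destruct (approx_compl _ (borel_approx A HA) e ltac:(unfold e; lra)) as (T & H1 & H2).
  assert (Hm : mean T <= b + e).
  { apply mean_le_outer; eapply outer_le_mono;
      [|apply Rle_refl|exact (outer_le_union _ _ _ _ Hb H2)].
    intros p [Hp Hin]; destruct (classic (A p)); [right | left]; unfold sq_compl; tauto. }
  destruct (Rle_dec (mean T + e) g') as [Hle|Hgt].
  - left; eapply outer_le_mono;
      [| |exact (outer_le_union _ _ _ _ (outer_le_region T) H1)]; [|exact Hle].
    intros p [Hp HnA]; unfold region; destruct (classic (in_tree T (fst p) (snd p))); tauto.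
  - right; destruct (tree_step T) as (phi & psi & G & Hc & HE).
    exists phi, psi; split; [exact G|].
    eapply outer_le_mono; [| |exact (outer_le_union _ _ _ _ Hc (HE _ _ H1))].
    + intros q (p & [Hp HnA] & <-).
      destruct (classic (in_tree T (fst p) (snd p))); [left | right]; exists p; unfold region; tauto.
    + set (m := mean T) in *.
      assert (Hv : g * g' / 4 <= m - m ^ 2).
      { assert (g' / 2 <= m) by (unfold e in *; lra).
        assert (g / 2 <= 1 - m) by (unfold e in *; lra).
        replace (g * g' / 4) with (g' / 2 * (g / 2)) by field.
        replace (m - m ^ 2) with (m * (1 - m)) by ring.
        apply Rmult_le_compat; lra. }
      unfold delta, e in *; lra.
Qed.

(** Once the target [g'] is reached the map is kept; otherwise one more shear is composed, at the
    price of a factor 2 in the Lipschitz constant. *)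
Lemma iterate_improve A b k : borel2 A -> outer_le (sq_compl A) b -> b <= 1 - g ->
  exists phi psi, bilip (2 ^ k) phi psi /\
    (outer_le (image2 phi (sq_compl A)) g' \/ outer_le (image2 phi (sq_compl A)) (b - INR k * delta)).
Proof.
  intros HA Hb Hbg; induction k as [|k (phi & psi & G & IH)].
  - exists (fun p => p), (fun p => p); split; [exact bilip_identity|].
    right; eapply outer_le_mono; [| |exact Hb]; [|simpl; lra].
    intros q (p & Hp & <-); exact Hp.
  - assert (Hpow : 0 < 2 ^ k) by (apply pow_lt; lra).
    destruct IH as [IH|IH].
    { exists phi, psi; split; [|left; exact IH].
      apply bilip_weaken with (2 ^ k); [simpl; lra | exact G]. }
    set (A' := fun p => A (psi p)).
    (* As [phi] permutes the square, the complement of the image of [A] is the image of its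
       complement. *)
    assert (Hco : forall q, sq_compl A' q <-> image2 phi (sq_compl A) q).
    { intros q; split.
      - intros [Hq HnA]; exists (psi q); split; [|apply (bilip_rl _ _ _ G)].
        split; [apply (bilip_square _ _ _ (bilip_sym _ _ _ G)), Hq | exact HnA].
      - intros (p & [Hp HnA] & <-); split; [apply (bilip_square _ _ _ G), Hp|].
        unfold A'; rewrite (bilip_lr _ _ _ G); exact HnA. }
    destruct (improve A' (b - INR k * delta)) as [Hdone|(phi' & psi' & G' & H')].
    + exact (borel_preimage _ phi psi A Hpow G HA).
    + eapply outer_le_mono; [apply Hco|apply Rle_refl|exact IH].
    + assert (0 <= INR k * delta).
      { apply Rmult_le_pos; [apply pos_INR|]; unfold delta.
        assert (0 < g * g') by (apply Rmult_lt_0_compat; lra); lra. }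
      lra.
    + exists phi, psi; split; [apply bilip_weaken with (2 ^ k); [simpl; lra | exact G]|].
      left; eapply outer_le_mono; [apply Hco|apply Rle_refl|exact Hdone].
    + exists (fun p => phi' (phi p)), (fun p => psi (psi' p)); split.
      { apply (bilip_comp (2 ^ k) 2); auto; lra. }
      right; eapply outer_le_mono; [| |exact H'].
      * intros q (p & Hp & <-); exists (phi p); split; [|reflexivity].
        apply Hco; exists p; auto.
      * rewrite S_INR; lra.
Qed.

End Iteration.

(** * Lebesgue outer measure and conclusion *)

Lemma cover_value_outer_le A s : cover_value A s -> outer_le A s.
Proof.
  intros (rs & H1 & H2 & H3) e He; exists rs; repeat split; auto.
  intros n; enough (sum_f_R0 (fun k => rect_area (rs k)) n <= s) by lra.
  apply sum_incr; [exact H3|].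
  intros k; apply rect_area_ge0, H1.
Qed.

Lemma outer_le_cover_value A s e : outer_le A s -> 0 < e -> exists s', s' <= s + e /\ cover_value A s'.
Proof.
  intros H He; destruct (H e He) as (rs & H1 & H2 & H3).
  destruct (growing_cv (sum_f_R0 (fun k => rect_area (rs k)))) as [l Hl].
  - intros n; simpl; pose proof (rect_area_ge0 _ (H1 (S n))); lra.
  - exists (s + e); intros z [n ->]; apply H3.
  - exists l; split.
    + apply Rle_cv_lim with (sum_f_R0 (fun k => rect_area (rs k))) (fun _ => s + e); auto.
      intros d Hd; exists 0%nat; intros n _; unfold Rdist; rewrite Rminus_diag, Rabs_R0; lra.
    + exists rs; repeat split; auto.
Qed.

Lemma lebesgue_outer_exists A s : outer_le A s -> exists m, lebesgue_outer A m.
Proof.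
  intros H.
  (* The infimum of the cover values is obtained as minus the supremum of their opposites. *)
  destruct (completeness (fun z => cover_value A (- z))) as [M [HM1 HM2]].
  - exists 0; intros z Hz.
    pose proof (outer_le_ge0 _ _ (cover_value_outer_le _ _ Hz)); lra.
  - destruct (outer_le_cover_value _ _ 1 H ltac:(lra)) as (s' & _ & Hs').
    exists (- s'); rewrite Ropp_involutive; exact Hs'.
  - exists (- M); split.
    + intros t Ht; assert (- t <= M); [|lra].
      apply HM1; rewrite Ropp_involutive; exact Ht.
    + intros m' Hm'; assert (M <= - m'); [|lra].
      apply HM2; intros z Hz; specialize (Hm' _ Hz); lra.
Qed.

Theorem theorem1 (gamma gamma' : R)
  (hg : 0 < gamma < 1) (hg' : 0 < gamma' < 1) (hsum : gamma + gamma' < 1) :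
  exists C0 : R, 0 < C0 /\
  forall A : set2,
    borel2 A -> (forall x, A x -> square x) -> lebesgue_outer A gamma ->
    exists phi0 : pt -> pt,
      (* phi0 is a bijection of [0,1]^2 onto itself *)
      (forall x, square x -> square (phi0 x)) /\
      (forall x y, square x -> square y -> phi0 x = phi0 y -> x = y) /\
      (forall y, square y -> exists x, square x /\ phi0 x = y) /\
      (* (1) C0-bi-Lipschitz *)
      (forall x y, square x -> square y ->
         / C0 * dist2 x y <= dist2 (phi0 x) (phi0 y) /\
         dist2 (phi0 x) (phi0 y) <= C0 * dist2 x y) /\
      (* (2) identity on the boundary *)
      (forall x, square_boundary x -> phi0 x = x) /\
      (* (3) lambda(phi0(A)) >= 1 - gamma' *)
      (exists m, lebesgue_outer (image2 phi0 A) m /\ 1 - gamma' <= m).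
Proof.
  assert (Hd : 0 < delta gamma gamma').
  { unfold delta; assert (0 < gamma * gamma') by (apply Rmult_lt_0_compat; lra); lra. }
  (* After [k >= 1 / delta] steps the bound [1 - gamma - k delta] would be negative, so in either
     alternative the complement has reached [gamma']. *)
  destruct (INR_unbounded (/ delta gamma gamma')) as [k Hk].
  assert (Hk' : 1 <= INR k * delta gamma gamma').
  { apply Rmult_le_reg_r with (/ delta gamma gamma'); [apply Rinv_0_lt_compat, Hd|].
    rewrite Rmult_assoc, Rinv_r; lra. }
  assert (Hpow : 0 < 2 ^ k) by (apply pow_lt; lra).
  (* The iteration gives [2^k] in the sum norm, and the passage to the Euclidean norm costs a factor
     2. *)
  set (C0 := 2 * 2 ^ k).
  exists C0; split; [unfold C0; lra|].
  intros A HA Hsub [Hout Hout'].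
  assert (Hco : outer_le (sq_compl A) (1 - gamma)).
  { apply outer_le_compl_of_borel; auto.
    intros s Hs; apply le_epsilon; intros e He.
    destruct (outer_le_cover_value _ _ e Hs He) as (s' & Hle & Hs'); specialize (Hout _ Hs'); lra. }
  destruct (iterate_improve gamma gamma' hg hg' A (1 - gamma) k HA Hco (Rle_refl _))
    as (phi & psi & G & Hphi).
  assert (Hsmall : outer_le (image2 phi (sq_compl A)) gamma').
  { destruct Hphi as [H|H]; [exact H|].
    eapply outer_le_mono; [intros x Hx; exact Hx | | exact H]; lra. }
  assert (Hsq := bilip_square _ _ _ G).
  assert (Hsq' := bilip_square _ _ _ (bilip_sym _ _ _ G)).
  assert (Hlip : forall L f h, bilip L f h -> 0 <= L -> forall x y,
    dist2 (f x) (f y) <= 2 * L * dist2 x y).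
  { intros L f h Gf HL x y; eapply Rle_trans; [apply dist2_le_dist1|].
    eapply Rle_trans; [apply (bilip_lip _ _ _ Gf)|].
    replace (2 * L * dist2 x y) with (L * (2 * dist2 x y)) by ring.
    apply Rmult_le_compat_l; [exact HL | apply dist1_le_dist2]. }
  exists phi; split; [exact Hsq|]; repeat split.
  - intros x y _ _ E; rewrite <- (bilip_lr _ _ _ G x), E; apply (bilip_lr _ _ _ G).
  - intros y Hy; exists (psi y); split; [apply Hsq', Hy | apply (bilip_rl _ _ _ G)].
  - pose proof (Hlip _ _ _ (bilip_sym _ _ _ G) ltac:(lra) (phi x) (phi y)) as H1.
    rewrite !(bilip_lr _ _ _ G) in H1; fold C0 in H1.
    apply Rmult_le_reg_l with C0; [unfold C0; lra|].
    rewrite <- Rmult_assoc, Rinv_r by (unfold C0; lra); lra.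
  - exact (Hlip _ _ _ G ltac:(lra) x y).
  - intros x [Hx Hb]; apply (bilip_id _ _ _ G); unfold open_square; lra.
  - destruct (lebesgue_outer_exists (image2 phi A) (rect_area (0, 1, 0, 1))) as [m Hm].
    { eapply outer_le_mono; [|apply Rle_refl|apply outer_le_rect; simpl; lra].
      intros q (p & Hp & <-); apply Hsub, Hsq in Hp; exact Hp. }
    exists m; split; [exact Hm|].
    apply Hm; intros s Hs.
    (* Any cover of the image of [A], together with the small image of the complement, covers the
       unit square. *)
    enough (1 <= s + gamma') by lra.
    apply outer_le_square_ge1.
    eapply outer_le_mono;
      [|apply Rle_refl|exact (outer_le_union _ _ _ _ (cover_value_outer_le _ _ Hs) Hsmall)].
    intros q Hq.
    destruct (classic (A (psi q))) as [HAq|HAq]; [left | right];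
      exists (psi q); split; auto; try apply (bilip_rl _ _ _ G).
    split; auto.
Qed.
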